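(* For every $\lambda\in(0,1)$, the dissipative outer billiard map $T$ about the equilateral triangle with contraction rate $\lambda$ has exactly $m_1=m_1(\lambda)$ distinct periodic orbits $\Gamma_{1,i}$, $i=1,\ldots,m_1$, where $\Gamma_{1,i}$ has period $3(2i-1)$, and exactly $m_2=m_2(\lambda)$ distinct periodic orbits $\Gamma_{2,i}$, $i=1,\ldots,m_2$, where $\Gamma_{2,i}$ has period $12i$. Moreover, for every non-singular $z\in X$ there exist $i\in\{1,2\}$ and $1\le j\le m_i$ such that $\operatorname{dist}(T^n(z),\Gamma_{i,j})\to 0$ as $n\to+\infty$.
   Context: Let $v=e^{2\pi i/3}$ and let $\Delta\subset\mathbb{C}$ be the closed equilateral triangle with corners $w_0=0$, $w_1=-v$, $w_2=1$ (counterclockwise order, indices mod $3$). Let $X=\mathbb{C}\setminus\Delta$ and let $A_i=\{w_i+x(w_{i-1}-w_i)+y(w_i-w_{i+1}) : x,y>0\}$, $i=0,1,2$; these are disjoint open cones in $X$. For $\lambda\in(0,1)$ the dissipative outer billiard map is $T(z)=-\lambda z+(1+\lambda)w_i$ for $z\in A_i$. The singular set is $\mathcal{S}=X\setminus(A_0\cup A_1\cup A_2)$, on which $T$ is not defined. A point $z\in X$ is non-singular if its forward orbit never meets $\mathcal{S}$ (so all iterates $T^n(z)$ are defined). $\operatorname{dist}$ is the Euclidean distance on $\mathbb{C}$. Periodic orbits are orbits of $T$ contained in $X\setminus\mathcal{S}$, and ''period'' means minimal period. For $n\ge1$ let $\lambda_n$ be the unique root in $[0,1)$ of $x^{2n}-x^n-x^{n-1}+1$,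 and for $n\ge 0$ let $\gamma_n$ be the unique root in $[0,1)$ of $x^{4n+4}-x^{3n+3}+x^{2n+2}-x^{2n+1}-x^{n+1}+1$; both sequences are strictly increasing and converge to $1$. For $\lambda\in(0,1)$, $m_1(\lambda)$ is the integer $n\ge1$ with $\lambda_{2n-1}<\lambda\le\lambda_{2n+1}$, and $m_2(\lambda)$ is the integer $n\ge1$ with $\gamma_{2n-1}<\lambda\le\gamma_{2n+1}$ if $\lambda>\gamma_1$, while $m_2(\lambda)=0$ if $\lambda\le\gamma_1$. *)

(* Defs.v *)
From Stdlib Require Export Reals ClassicalEpsilon.
From Coquelicot Require Export Coquelicot.

Open Scope R_scope.

(* [cis t] is e^{it}; the complex exponential is not in Coquelicot. *)
Definition cis (t : R) : C := (cos t, sin t).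

Definition v : C := cis (2 * PI / 3).

(* Corners, with index taken mod 3; hence w_{i-1} is [w (i + 2)]. *)
Definition w (i : nat) : C :=
  match (i mod 3)%nat with
  | 0%nat => 0%C
  | 1%nat => (- v)%C
  | _ => 1%C
  end.

Definition Delta (z : C) : Prop :=
  exists a b c : R, 0 <= a /\ 0 <= b /\ 0 <= c /\ a + b + c = 1 /\
    z = (a * w 0 + b * w 1 + c * w 2)%C.

Definition X (z : C) : Prop := ~ Delta z.

Definition A (i : nat) (z : C) : Prop :=
  exists x y : R, 0 < x /\ 0 < y /\
    z = (w i + x * (w (i + 2) - w i) + y * (w i - w (i + 1)))%C.

Definition Sing (z : C) : Prop := X z /\ ~ (A 0 z \/ A 1 z \/ A 2 z).

(* The cones are disjoint, so the order of the tests is irrelevant.  The map is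
   undefined outside the cones; the value 0 there is a dummy, and the dynamical
   notions below only look at orbits that stay in the cones. *)
Definition T (lam : R) (z : C) : C :=
  if excluded_middle_informative (A 0 z) then (- lam * z + (1 + lam) * w 0)%C
  else if excluded_middle_informative (A 1 z) then (- lam * z + (1 + lam) * w 1)%C
  else if excluded_middle_informative (A 2 z) then (- lam * z + (1 + lam) * w 2)%C
  else 0%C.

Definition iterT (lam : R) (n : nat) (z : C) : C := Nat.iter n (T lam) z.

Definition nonsingular (lam : R) (z : C) : Prop :=
  X z /\ forall n : nat, ~ Sing (iterT lam n z).

Definition orbit (lam : R) (z : C) : C -> Prop :=
  fun y => exists n : nat, y = iterT lam n z.

Definition minimal_period (lam : R) (p : nat) (z : C) : Prop :=
  (0 < p)%nat /\ iterT lam p z = z /\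
  forall q : nat, (0 < q < p)%nat -> iterT lam q z <> z.

Definition periodic_orbit (lam : R) (p : nat) (G : C -> Prop) : Prop :=
  exists z : C, nonsingular lam z /\ minimal_period lam p z /\ G = orbit lam z.

(* Used for nonempty [G] only, where the infimum is finite. *)
Definition dist_set (z : C) (G : C -> Prop) : R :=
  real (Glb_Rbar (fun r => exists y : C, G y /\ r = Cmod (z - y)%C)).

(* [epsilon] selects the unique root, respectively the unique index, with the
   given property.  The sequences are meaningful for n >= 1 ([lambda_seq]) and
   n >= 0 ([gamma_seq]). *)
Definition lambda_seq (n : nat) : R :=
  epsilon (inhabits 0) (fun x : R =>
    0 <= x < 1 /\ x ^ (2 * n) - x ^ n - x ^ (n - 1) + 1 = 0).

Definition gamma_seq (n : nat) : R :=
  epsilon (inhabits 0) (fun x : R =>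
    0 <= x < 1 /\
    x ^ (4 * n + 4) - x ^ (3 * n + 3) + x ^ (2 * n + 2) - x ^ (2 * n + 1)
      - x ^ (n + 1) + 1 = 0).

Definition m1 (lam : R) : nat :=
  epsilon (inhabits 0%nat) (fun n : nat => (1 <= n)%nat /\
    lambda_seq (2 * n - 1) < lam <= lambda_seq (2 * n + 1)).

Definition m2 (lam : R) : nat :=
  if Rlt_dec (gamma_seq 1) lam then
    epsilon (inhabits 0%nat) (fun n : nat => (1 <= n)%nat /\
      gamma_seq (2 * n - 1) < lam <= gamma_seq (2 * n + 1))
  else 0%nat.

(* Main.v *)
Require Import Defs.
From Stdlib Require Import Lra Lia FunctionalExtensionality PropExtensionality.

(** Write mu_k = lam^(2k+1).  The proof rests on an explicit first return map
    and on the short list of symbol sequences that this map allows.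

    Coordinates.  The rotation symmetry makes all cones alike: the point with
    cone coordinates x = (V - W)/(1 - lam), y = (V - 1)/(1 - lam) lies in A_i iff
    V > 1 and V > W.  The map T sends it to (1 + lam (V - W), lam V) in the next
    cone if lam W < 1, and to (lam W, lam (1 - V + W)) in the previous one if
    lam W > 1; the image is singular if lam W = 1 ([T_next_cone],
    [T_prev_cone]).  Two consecutive steps of the second and the first kind
    multiply W by lam^2 and V - 1 by lam^2, so every non-singular orbit enters
    the section lam < W < 1/lam ([reaches_section]).  From a section point,
    the first return takes 2k+1 steps, where k is determined by
    lam < mu_k V < 1/lam; it moves to the next cone and acts by
    (V, W) |-> (1 + mu_k (V - W), mu_k V) ([excursion]).

    Symbols.  Along an orbit with symbols k_n, two returns give
    V_(n+2) = 1 + mu_(k_(n+1)) (1 - mu_(k_n) W_n), and W_n is confined to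
    (lam, 1/lam).  Hence a symbol rises by at most one, and after a rise from k
    or a repetition of k the next symbol is at most k ([symbol_step],
    [symbol_after_rise], [symbol_after_repeat]).  These rules make
    max (k_n, k_(n+1)) nonincreasing, and once it is constant the symbols are
    either constant or alternate between K and K+1 ([constant_or_alternating]).

    Attraction.  Symbols determine the cones visited at all times, and within
    one cone T multiplies differences by -lam.  So two orbits with the same
    symbols approach each other like lam^n ([coded_contraction]), and it
    suffices to find one periodic orbit for each admissible pattern.

    Existence.  In suitable linear coordinates, the return map with constant symbol K
    is a rotation by 60 degrees times mu_K about its fixed point, whose W is W*; so
    that W_(n+3) + mu^3 W_n is a positive multiple of W*.  As all W_n exceed lam,
    an orbit with these symbols forces W* > lam, and this inequality is
    sufficient for the fixed point to be a genuine orbit; the point never ends up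
    on the singular boundary.  The alternating pattern is treated in the same
    way, with rotations by 120 degrees.  The inequality is the negativity at lam of
    the polynomial that defines lambda_(2K+1), resp. gamma_(2K+1).  On
    (0,1) each of these polynomials is negative exactly to the right of its root,
    so the inequality says that lam exceeds the root, and m1 and m2 count the
    admissible K ([m1_spec], [m2_spec]).

    Periods.  The fixed point needs 3 returns of 2K+1 steps to come back to its
    cone; the 2-cycle needs 6 returns, of 2K+1 and 2K+3 steps alternately.  *)

(** * Barycentric coordinates and the map in one cone *)

Lemma three_step_ind (P : nat -> Prop) :
  P 0%nat -> P 1%nat -> P 2%nat -> (forall i, P i -> P (i + 3)%nat) ->
  forall i, P i.
Proof.
  intros H0 H1 H2 HS i.
  assert (H : P i /\ P (S i) /\ P (S (S i))).
  { induction i as [|i [Ha [Hb Hc]]]; repeat split; auto.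
    replace (S (S (S i))) with (i + 3)%nat by lia. auto. }
  tauto.
Qed.

Lemma w_add3 i : w (i + 3) = w i.
Proof.
  unfold w. replace (i + 3)%nat with (i + 1 * 3)%nat by lia.
  now rewrite Nat.Div0.mod_add.
Qed.

(** The barycentric coordinate of z at the corner w i.  The whole problem is affine,
    so Im v <> 0 is the only property of v that enters. *)
Definition bary (i : nat) (z : C) : R :=
  match (i mod 3)%nat with
  | 0%nat => 1 + Im z / Im v - (Re z - Re v * Im z / Im v)
  | 1%nat => - Im z / Im v
  | _ => Re z - Re v * Im z / Im v
  end.

Lemma bary_add3 i z : bary (i + 3) z = bary i z.
Proof.
  unfold bary. replace (i + 3)%nat with (i + 1 * 3)%nat by lia.
  now rewrite Nat.Div0.mod_add.
Qed.

Lemma Im_v_pos : 0 < Im v.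
Proof.
  unfold v, cis; simpl. pose proof PI_RGT_0. apply sin_gt_0; lra.
Qed.

Definition cone_coord (i : nat) (x y : R) : C :=
  (w i + x * (w (i + 2) - w i) + y * (w i - w (i + 1)))%C.

Lemma cone_coord_add3 i x y : cone_coord (i + 3) x y = cone_coord i x y.
Proof.
  unfold cone_coord.
  replace (i + 3 + 2)%nat with (i + 2 + 3)%nat by lia.
  replace (i + 3 + 1)%nat with (i + 1 + 3)%nat by lia.
  now rewrite !w_add3.
Qed.

Lemma bary_cone_coord i x y :
  bary i (cone_coord i x y) = 1 - x + y /\
  bary (i + 1) (cone_coord i x y) = - y /\
  bary (i + 2) (cone_coord i x y) = x.
Proof.
  pose proof Im_v_pos as Hv.
  induction i as [| | |i IH] using three_step_ind;
    [| | | replace (i + 3 + 1)%nat with (i + 1 + 3)%nat by lia;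
           replace (i + 3 + 2)%nat with (i + 2 + 3)%nat by lia;
           now rewrite cone_coord_add3, !bary_add3];
    unfold bary, cone_coord, w, Re, Im in *; destruct v as [vr vi]; simpl in *;
    repeat split; field; lra.
Qed.

Lemma bary_Delta z : Delta z -> forall i, 0 <= bary i z.
Proof.
  pose proof Im_v_pos as Hv.
  intros (a & b & c & Ha & Hb & Hc & Habc & ->) i.
  replace a with (1 - b - c) in * by lra. clear Habc.
  induction i as [| | |i IH] using three_step_ind; [| | | now rewrite bary_add3];
    unfold bary, w, Re, Im in *; destruct v as [vr vi]; simpl in *;
    match goal with |- 0 <= ?e => first
      [ replace e with (1 - b - c) by (field; lra)
      | replace e with b by (field; lra)
      | replace e with c by (field; lra) ] end; lra.
Qed.

Lemma A_add3 i z : A (i + 3) z <-> A i z.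
Proof.
  split; intros (x & y & Hx & Hy & ->); exists x, y; repeat split; trivial;
    fold (cone_coord i x y) (cone_coord (i + 3) x y);
    now rewrite cone_coord_add3.
Qed.

(** The signs of two barycentric coordinates single out a cone; this is how
    the cones are seen to be disjoint from each other and from the triangle. *)
Lemma A_bary i z : A i z -> bary (i + 1) z < 0 /\ 0 < bary (i + 2) z.
Proof.
  intros (x & y & Hx & Hy & ->). fold (cone_coord i x y).
  destruct (bary_cone_coord i x y) as (_ & -> & ->). lra.
Qed.

Lemma T_on_cone lam i z :
  A i z -> T lam z = (- lam * z + (1 + lam) * w i)%C.
Proof.
  induction i as [| | |i IH] using three_step_ind.
  4: { rewrite A_add3, w_add3. exact IH. }
  all: intros H; unfold T;
    repeat match goal with |- context [excluded_middle_informative ?P] =>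
      destruct (excluded_middle_informative P) as [?|?] end;
    try tauto; trivial; exfalso;
    repeat match goal with Ha : A _ _ |- _ => apply A_bary in Ha end;
    unfold bary in *; simpl in *; lra.
Qed.

(** In V and W the double steps of the map, which act on the cone coordinates by
    x |-> lam^2 x + 1 + lam and y |-> lam^2 y, become scalings of V - 1 and W by
    lam^2; the cone is V > 1, V > W. *)
Definition cone_point (lam : R) (i : nat) (V W : R) : C :=
  cone_coord i ((V - W) / (1 - lam)) ((V - 1) / (1 - lam)).

Section Dynamics.
Variable lam : R.
Hypothesis Hlam : 0 < lam < 1.

Lemma cone_point_add3 i q V W : cone_point lam (i + 3 * q) V W = cone_point lam i V W.
Proof.
  induction q as [|q IH]; [f_equal; lia|].
  replace (i + 3 * S q)%nat with (i + 3 * q + 3)%nat by lia.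
  rewrite <- IH. unfold cone_point. now rewrite cone_coord_add3.
Qed.

Lemma A_cone_point i V W : 1 < V -> W < V -> A i (cone_point lam i V W).
Proof.
  intros HV HW. exists ((V - W) / (1 - lam)), ((V - 1) / (1 - lam)).
  repeat split; apply Rdiv_lt_0_compat; lra.
Qed.

Lemma cone_point_of_A i z : A i z -> exists V W, 1 < V /\ W < V /\ z = cone_point lam i V W.
Proof.
  intros (x & y & Hx & Hy & ->).
  exists (1 + (1 - lam) * y), (1 + (1 - lam) * y - (1 - lam) * x).
  repeat split; [nra|nra|]. unfold cone_point. fold (cone_coord i x y).
  f_equal; field; lra.
Qed.

Lemma X_cone_point i V W : 1 < V -> X (cone_point lam i V W).
Proof.
  intros HV HD. pose proof (bary_Delta _ HD (i + 1)) as H.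
  unfold cone_point in H. destruct (bary_cone_coord i ((V - W) / (1 - lam)) ((V - 1) / (1 - lam)))
    as (_ & Hb & _).
  rewrite Hb in H.
  assert (0 < (V - 1) / (1 - lam)) by (apply Rdiv_lt_0_compat; lra). lra.
Qed.

(** One of the two points may lie on the edge V = W of its cone: this is what
    excludes that an edge point belongs to any open cone, and thus identifies
    singular points. *)
Lemma cone_point_inj i j V W V' W' :
  1 < V -> W <= V -> 1 < V' -> W' < V' -> cone_point lam i V W = cone_point lam j V' W' ->
  (i mod 3 = j mod 3)%nat /\ V = V' /\ W = W'.
Proof.
  intros HV HW HV' HW' E.
  assert (Hd : (i mod 3 = j mod 3 \/ (i + 1) mod 3 = j mod 3 \/
                (i + 2) mod 3 = j mod 3)%nat).
  { pose proof (Nat.div_mod_eq i 3). pose proof (Nat.div_mod_eq j 3).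
    pose proof (Nat.mod_upper_bound i 3). pose proof (Nat.mod_upper_bound j 3).
    pose proof (Nat.div_mod_eq (i+1) 3). pose proof (Nat.div_mod_eq (i+2) 3).
    pose proof (Nat.mod_upper_bound (i+1) 3). pose proof (Nat.mod_upper_bound (i+2) 3). lia. }
  assert (Hbm : forall a b z, (a mod 3 = b mod 3)%nat -> bary a z = bary b z)
    by (intros a b z Hab; unfold bary; now rewrite Hab).
  assert (Hm : forall a b c, (a mod 3 = b mod 3 -> (a + c) mod 3 = (b + c) mod 3)%nat)
    by (intros a b c Hab; now rewrite (Nat.Div0.add_mod a), (Nat.Div0.add_mod b), Hab).
  set (z := cone_point lam i V W) in *.
  assert (B : bary (i + 1) z = - ((V - 1) / (1 - lam)) /\
              bary (i + 2) z = (V - W) / (1 - lam))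
    by apply bary_cone_coord.
  assert (B' : bary (j + 1) z = - ((V' - 1) / (1 - lam)) /\
               bary (j + 2) z = (V' - W') / (1 - lam))
    by (rewrite E; apply bary_cone_coord).
  assert (P1 : 0 < (V - 1) / (1 - lam)) by (apply Rdiv_lt_0_compat; lra).
  assert (P2 : 0 <= (V - W) / (1 - lam)) by (apply Rdiv_le_0_compat; lra).
  assert (P3 : 0 < (V' - 1) / (1 - lam)) by (apply Rdiv_lt_0_compat; lra).
  assert (P4 : 0 < (V' - W') / (1 - lam)) by (apply Rdiv_lt_0_compat; lra).
  destruct Hd as [H|[H|H]].
  - rewrite (Hbm _ _ z (Hm _ _ 1%nat H)), (Hbm _ _ z (Hm _ _ 2%nat H)) in B.
    split; trivial. destruct B as [B1 B2], B' as [B1' B2']. rewrite B1 in B1'. rewrite B2 in B2'.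
    assert (V = V').
    { apply Rmult_eq_reg_r with (/ (1 - lam)); [|apply Rinv_neq_0_compat; lra].
      unfold Rdiv in *. lra. }
    split; trivial. subst V'.
    apply Rmult_eq_reg_r with (/ (1 - lam)); [|apply Rinv_neq_0_compat; lra].
    unfold Rdiv in *. lra.
  - exfalso. pose proof (Hbm _ _ z (Hm _ _ 1%nat H)) as H1.
    replace (i + 1 + 1)%nat with (i + 2)%nat in H1 by lia. lra.
  - exfalso. pose proof (Hbm _ _ z (Hm _ _ 2%nat H)) as H1.
    replace (i + 2 + 2)%nat with (i + 1 + 3)%nat in H1 by lia.
    rewrite bary_add3 in H1. lra.
Qed.

(** T sends the cone A_i onto the opposite cone at the corner w i.  This identity and
    the next one describe the image in the coordinates of the two cones that
    the opposite cone meets; lam * W < 1 or lam * W > 1 decides which of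
    the two descriptions satisfies the cone inequalities. *)
Lemma T_next_cone i V W : 1 < V -> W < V ->
  T lam (cone_point lam i V W) = cone_point lam (i + 1) (1 + lam * (V - W)) (lam * V).
Proof.
  intros HV HW. rewrite (T_on_cone lam i) by now apply A_cone_point.
  unfold cone_point, cone_coord.
  replace (i + 1 + 2)%nat with (i + 3)%nat by lia.
  replace (i + 1 + 1)%nat with (i + 2)%nat by lia. rewrite w_add3.
  destruct (w i) as [a0 b0], (w (i + 1)) as [a1 b1], (w (i + 2)) as [a2 b2].
  apply injective_projections; simpl; field; lra.
Qed.

Lemma T_prev_cone i V W : 1 < V -> W < V ->
  T lam (cone_point lam i V W) = cone_point lam (i + 2) (lam * W) (lam * (1 - V + W)).
Proof.
  intros HV HW. rewrite (T_on_cone lam i) by now apply A_cone_point.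
  unfold cone_point, cone_coord.
  replace (i + 2 + 2)%nat with (i + 1 + 3)%nat by lia.
  replace (i + 2 + 1)%nat with (i + 3)%nat by lia. rewrite !w_add3.
  destruct (w i) as [a0 b0], (w (i + 1)) as [a1 b1], (w (i + 2)) as [a2 b2].
  apply injective_projections; simpl; field; lra.
Qed.

Lemma iterT_add m n z : iterT lam (m + n) z = iterT lam m (iterT lam n z).
Proof. apply Nat.iter_add. Qed.

Lemma nonsingular_in_cone z : nonsingular lam z ->
  exists i V W, 1 < V /\ W < V /\ z = cone_point lam i V W.
Proof.
  intros [HX HS]. specialize (HS 0%nat). simpl in HS.
  assert (H : A 0 z \/ A 1 z \/ A 2 z) by (apply NNPP; intros H; apply HS; now split).
  destruct H as [H|[H|H]]; apply cone_point_of_A in H; eauto.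
Qed.

Lemma nonsingular_iter n z : nonsingular lam z -> nonsingular lam (iterT lam n z).
Proof.
  intros Hz. induction n as [|n IH]; [exact Hz|].
  destruct (nonsingular_in_cone _ IH) as (i & V & W & HV & HW & E).
  split.
  - change (X (T lam (iterT lam n z))). rewrite E, T_next_cone by trivial. apply X_cone_point. nra.
  - intros m. rewrite <- iterT_add. apply Hz.
Qed.

Lemma iterT_S n z : iterT lam (S n) z = T lam (iterT lam n z).
Proof. reflexivity. Qed.

(** If lam * W = 1, then the image lies on the edge V = W of the next cone. *)
Lemma nonsingular_off_line i V W :
  1 < V -> W < V -> nonsingular lam (cone_point lam i V W) -> lam * W <> 1.
Proof.
  intros HV HW Hz E.
  destruct (nonsingular_in_cone _ (nonsingular_iter 1 _ Hz)) as (j & V' & W' & HV' & HW' & E').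
  simpl in E'. rewrite T_next_cone in E' by trivial.
  apply cone_point_inj in E'; trivial; nra.
Qed.

(** * First return to the section *)

Lemma odd_pow j : lam ^ (2 * j + 1) = lam * lam ^ (2 * j).
Proof. rewrite pow_add. simpl. ring. Qed.

Lemma even_pow_S j : lam ^ (2 * S j) = lam * lam * lam ^ (2 * j).
Proof. replace (2 * S j)%nat with (S (S (2 * j))) by lia. simpl. ring. Qed.

Lemma pow_lam_bounds n : 0 < lam ^ n <= 1.
Proof.
  induction n as [|n IH]; simpl; [lra|]. nra.
Qed.

Lemma pow_lam_small c : 0 < c -> exists n, lam ^ (2 * n) < c.
Proof.
  intros Hc. destruct (pow_lt_1_zero lam) with (y := c) as [n Hn]; trivial.
  { rewrite Rabs_pos_eq; lra. }
  exists n. specialize (Hn (2 * n)%nat ltac:(lia)).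
  rewrite Rabs_pos_eq in Hn; trivial. apply Rlt_le, pow_lam_bounds.
Qed.

(** As long as lam * W > 1, the orbit goes to the previous cone and back: two
    steps scale both V - 1 and W by lam^2. *)
Lemma bounce i j V W : 1 < V -> W < V ->
  (j <> 0%nat -> lam < lam ^ (2 * j) * W) ->
  iterT lam (2 * j) (cone_point lam i V W) =
  cone_point lam i (1 + lam ^ (2 * j) * (V - 1)) (lam ^ (2 * j) * W) /\
  1 < 1 + lam ^ (2 * j) * (V - 1) /\
  lam ^ (2 * j) * W < 1 + lam ^ (2 * j) * (V - 1).
Proof.
  intros HV HW. induction j as [|j IH]; intros Hj.
  { simpl. split; [f_equal; ring | lra]. }
  specialize (Hj ltac:(lia)). rewrite even_pow_S in *.
  pose proof (pow_lam_bounds (2 * j)) as Hp.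
  set (p := lam ^ (2 * j)) in *.
  assert (Hj' : 1 < lam * (p * W)) by nra.
  destruct IH as [E [H1 H2]]; [intros _; nra|].
  replace (2 * S j)%nat with (S (S (2 * j))) by lia.
  rewrite !iterT_S, E, T_prev_cone, T_next_cone by (trivial; nra).
  replace (i + 2 + 1)%nat with (i + 3 * 1)%nat by lia. rewrite cone_point_add3.
  split; [f_equal; ring | nra].
Qed.

(** The scaling by lam^2 cannot jump over the window (lam, 1/lam), whose endpoints
    have ratio lam^2, and non-singularity keeps W off the endpoint 1/lam. *)
Lemma descent i V W :
  1 < V -> W < V -> lam < W -> nonsingular lam (cone_point lam i V W) ->
  exists j, lam < lam ^ (2 * j) * W /\ lam * (lam ^ (2 * j) * W) < 1.
Proof.
  intros HV HW HlW Hz.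
  assert (Hex : exists n, lam * (lam ^ (2 * n) * W) < 1).
  { destruct (pow_lam_small (/ W)) as [n Hn]; [apply Rinv_0_lt_compat; lra|].
    exists n. pose proof (pow_lam_bounds (2 * n)).
    apply Rmult_lt_compat_r with (r := W) in Hn; [|lra].
    rewrite Rinv_l in Hn by lra. nra. }
  destruct Hex as [n Hn].
  assert (H : forall m, (exists j, lam < lam ^ (2 * j) * W /\ lam * (lam ^ (2 * j) * W) < 1)
              \/ lam < lam ^ (2 * m) * W /\ 1 < lam * (lam ^ (2 * m) * W)).
  { induction m as [|m [IH|[IH1 IH2]]].
    - simpl. assert (Hne := nonsingular_off_line i V W HV HW Hz).
      destruct (Rlt_le_dec (lam * W) 1) as [H|H].
      + left. exists 0%nat. simpl. lra.
      + right. lra.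
    - now left.
    - assert (Hl : lam < lam ^ (2 * S m) * W) by (rewrite even_pow_S; nra).
      destruct (bounce i (S m) V W HV HW ltac:(auto)) as [E [H1 H2]].
      assert (Hne : lam * (lam ^ (2 * S m) * W) <> 1).
      { apply (nonsingular_off_line i (1 + lam ^ (2 * S m) * (V - 1))); trivial.
        rewrite <- E. now apply nonsingular_iter. }
      destruct (Rlt_le_dec (lam * (lam ^ (2 * S m) * W)) 1) as [H|H].
      + left. now exists (S m).
      + right. split; [exact Hl|lra]. }
  destruct (H n) as [|[_ H']]; [trivial|lra].
Qed.

Definition in_section (V W : R) : Prop :=
  1 < V /\ W < V /\ lam < W /\ lam * W < 1.

Lemma next_in_section k V W :
  in_section V W ->
  lam < lam ^ (2 * k + 1) * V -> lam * (lam ^ (2 * k + 1) * V) < 1 ->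
  in_section (1 + lam ^ (2 * k + 1) * (V - W)) (lam ^ (2 * k + 1) * V).
Proof.
  intros (HV & HW & HlW & HWl) H1 H2. rewrite odd_pow in *.
  pose proof (pow_lam_bounds (2 * k)) as Hp. set (p := lam ^ (2 * k)) in *.
  unfold in_section. repeat split; trivial; [nra|].
  assert (p * (lam * W) < 1) by nra. nra.
Qed.

Lemma reaches_section z : nonsingular lam z ->
  exists t i V W, in_section V W /\ iterT lam t z = cone_point lam i V W.
Proof.
  intros Hz.
  assert (Hhigh : forall z, nonsingular lam z -> forall i V W,
    1 < V -> W < V -> lam < W -> z = cone_point lam i V W ->
    exists t i V W, in_section V W /\ iterT lam t z = cone_point lam i V W).
  { clear z Hz. intros z Hz i V W HV HW HlW ->.
    destruct (descent i V W HV HW HlW Hz) as (j & Hj1 & Hj2).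
    destruct (bounce i j V W HV HW ltac:(auto)) as [E [H1 H2]].
    exists (2 * j)%nat, i. do 2 eexists. split; [|exact E]. now repeat split. }
  destruct (nonsingular_in_cone z Hz) as (i & V & W & HV & HW & ->).
  destruct (Rlt_le_dec lam W) as [H|H].
  - eapply Hhigh; eauto.
  - destruct (Hhigh _ (nonsingular_iter 1 _ Hz) (i + 1)%nat
      (1 + lam * (V - W)) (lam * V)) as (t & j & V' & W' & Hs & E); try nra.
    { apply T_next_cone; trivial. }
    exists (t + 1)%nat, j, V', W'. split; trivial. now rewrite iterT_add.
Qed.

(** The two sides of the section within a cone.  An intermediate point of an
    excursion lies on one of them, and is thereby told from a return. *)
Definition off_section (z : C) : Prop :=
  exists j V W, 1 < V /\ W < V /\ (W < lam \/ 1 < lam * W) /\ z = cone_point lam j V W.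

Lemma not_off_section i V W : in_section V W -> ~ off_section (cone_point lam i V W).
Proof.
  intros (H1 & H2 & H3 & H4) (j & V' & W' & H1' & H2' & H3' & E).
  apply cone_point_inj in E; trivial; try lra. destruct E as (_ & -> & ->). lra.
Qed.

(** One step into the next cone, then k bounces between that cone and the
    original one; the bounces stop exactly when W = mu V enters (lam, 1/lam). *)
Lemma excursion i k V W :
  in_section V W ->
  lam < lam ^ (2 * k + 1) * V -> lam * (lam ^ (2 * k + 1) * V) < 1 ->
  iterT lam (2 * k + 1) (cone_point lam i V W) =
    cone_point lam (i + 1) (1 + lam ^ (2 * k + 1) * (V - W)) (lam ^ (2 * k + 1) * V) /\
  forall q, (q <= 2 * k)%nat ->
    A (i + q mod 2) (iterT lam q (cone_point lam i V W)) /\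
    (q <> 0%nat -> off_section (iterT lam q (cone_point lam i V W))).
Proof.
  intros (HV & HW & HlW & HWl) H1 H2.
  rewrite odd_pow in *.
  assert (HV1 : 1 < 1 + lam * (V - W)) by nra.
  assert (HW1 : lam * V < 1 + lam * (V - W)) by nra.
  assert (Hsucc : forall q, iterT lam (q + 1) (cone_point lam i V W) =
            iterT lam q (cone_point lam (i + 1) (1 + lam * (V - W)) (lam * V))).
  { intros q. rewrite iterT_add. f_equal. now apply T_next_cone. }
  assert (Hj : forall j, (j <= k)%nat -> lam < lam ^ (2 * j) * (lam * V)).
  { intros j Hj. assert (lam ^ (2 * k) <= lam ^ (2 * j)).
    { replace (2 * k)%nat with (2 * (k - j) + 2 * j)%nat by lia. rewrite pow_add.
      pose proof (pow_lam_bounds (2 * (k - j))). pose proof (pow_lam_bounds (2 * j)). nra. }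
    assert (0 < lam * V) by nra.
    apply Rlt_le_trans with (lam ^ (2 * k) * (lam * V)); [|apply Rmult_le_compat_r]; lra. }
  split.
  - rewrite Hsucc. destruct (bounce (i + 1) k _ _ HV1 HW1) as [-> _]; [auto|].
    f_equal; ring.
  - intros q Hq. destruct q as [|q].
    { split; [|easy]. rewrite Nat.add_0_r. now apply A_cone_point. }
    replace (S q) with (q + 1)%nat by lia. rewrite Hsucc.
    destruct (Nat.Even_or_Odd q) as [[j ->]|[j ->]].
    + assert (Hj' : 1 < lam * (lam ^ (2 * j) * (lam * V))).
      { specialize (Hj (S j) ltac:(lia)). rewrite even_pow_S in Hj.
        replace (lam * lam * lam ^ (2 * j) * (lam * V))
          with (lam * (lam * (lam ^ (2 * j) * (lam * V)))) in Hj by ring. nra. }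
      destruct (bounce (i + 1) j _ _ HV1 HW1) as [-> [B1 B2]]; [auto with zarith|].
      replace ((2 * j + 1) mod 2)%nat with 1%nat
        by (rewrite Nat.add_comm, Nat.mul_comm, Nat.Div0.mod_add; reflexivity).
      split; [now apply A_cone_point|]. intros _. do 3 eexists. repeat split; eauto.
    + destruct (bounce (i + 1) j _ _ HV1 HW1) as [E [B1 B2]]; [auto with zarith|].
      assert (Hj' : 1 < lam * (lam ^ (2 * j) * (lam * V))).
      { specialize (Hj (S j) ltac:(lia)). rewrite even_pow_S in Hj.
        replace (lam * lam * lam ^ (2 * j) * (lam * V))
          with (lam * (lam * (lam ^ (2 * j) * (lam * V)))) in Hj by ring. nra. }
      replace ((2 * j + 1 + 1) mod 2)%nat with 0%nat
        by (replace (2 * j + 1 + 1)%nat with ((j + 1) * 2)%nat by lia;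
            now rewrite Nat.Div0.mod_mul).
      replace (2 * j + 1)%nat with (S (2 * j)) by lia.
      rewrite iterT_S, E, T_prev_cone by trivial.
      replace (i + 1 + 2)%nat with (i + 0 + 3 * 1)%nat by lia. rewrite cone_point_add3.
      split; [apply A_cone_point; nra|]. intros _.
      refine (ex_intro _ _ (ex_intro _ _ (ex_intro _ _ (conj _ (conj _ (conj _ eq_refl)))))); nra.
Qed.

End Dynamics.

(** * Symbol sequences of orbits *)

Section Coding.
Variable lam : R.
Hypothesis Hlam : 0 < lam < 1.

(** An orbit of the return map together with its symbols.  Since the inequalities
    are part of the definition, every solution is the trace of a true orbit
    of T, and the index of the starting cone remains free. *)
Definition coded (k : nat -> nat) (V W : nat -> R) : Prop :=
  forall n, in_section lam (V n) (W n) /\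
    lam < lam ^ (2 * k n + 1) * V n /\ lam * (lam ^ (2 * k n + 1) * V n) < 1 /\
    V (S n) = 1 + lam ^ (2 * k n + 1) * (V n - W n) /\
    W (S n) = lam ^ (2 * k n + 1) * V n.

Fixpoint return_time (k : nat -> nat) (n : nat) : nat :=
  match n with
  | 0%nat => 0%nat
  | S n => (2 * k n + 1 + return_time k n)%nat
  end.

Lemma return_time_cover k q : exists n j, q = (j + return_time k n)%nat /\ (j <= 2 * k n)%nat.
Proof.
  induction q as [|q (n & j & -> & Hj)].
  - exists 0%nat, 0%nat. simpl. lia.
  - destruct (Nat.eq_dec j (2 * k n)) as [->|Hne].
    + exists (S n), 0%nat. simpl. lia.
    + exists n, (S j). lia.
Qed.

Lemma return_time_mono k m n : (m < n)%nat -> (return_time k m < return_time k n)%nat.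
Proof. induction 1; simpl; lia. Qed.

Lemma coded_orbit k V W i n : coded k V W ->
  iterT lam (return_time k n) (cone_point lam i (V 0%nat) (W 0%nat)) =
  cone_point lam (i + n) (V n) (W n).
Proof.
  intros Hc. induction n as [|n IH].
  - rewrite Nat.add_0_r. reflexivity.
  - cbn [return_time]. rewrite iterT_add, IH. destruct (Hc n) as (Hs & H1 & H2 & -> & ->).
    destruct (excursion lam Hlam (i + n) (k n) (V n) (W n) Hs H1 H2) as [-> _].
    f_equal; lia.
Qed.

Lemma coded_between k V W i n j : coded k V W -> (j <= 2 * k n)%nat ->
  A (i + n + j mod 2) (iterT lam (j + return_time k n) (cone_point lam i (V 0%nat) (W 0%nat))) /\
  (j <> 0%nat ->
   off_section lam (iterT lam (j + return_time k n) (cone_point lam i (V 0%nat) (W 0%nat)))).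
Proof.
  intros Hc Hj. rewrite iterT_add, (coded_orbit _ _ _ _ _ Hc).
  destruct (Hc n) as (Hs & H1 & H2 & _).
  now apply (excursion lam Hlam (i + n) (k n) (V n) (W n) Hs H1 H2).
Qed.

Lemma coded_nonsingular k V W i : coded k V W ->
  nonsingular lam (cone_point lam i (V 0%nat) (W 0%nat)).
Proof.
  intros Hc. split.
  - apply X_cone_point; trivial. apply (Hc 0%nat).
  - intros q [_ Hq]. apply Hq.
    destruct (return_time_cover k q) as (n & j & -> & Hj).
    destruct (coded_between k V W i n j Hc Hj) as [HA _].
    revert HA. generalize (i + n + j mod 2)%nat. intros a.
    induction a as [| | |a IH] using three_step_ind; [tauto..|].
    now rewrite A_add3.
Qed.

(** The symbols determine the cone visited at each time, not only at return
    times, and T is the same similarity of ratio lam on a whole cone.  The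
    initial distance thus shrinks by exactly lam at each step. *)
Lemma coded_contraction k V W V' W' i q : coded k V W -> coded k V' W' ->
  Cmod (iterT lam q (cone_point lam i (V 0%nat) (W 0%nat)) -
        iterT lam q (cone_point lam i (V' 0%nat) (W' 0%nat)))%C =
  lam ^ q * Cmod (cone_point lam i (V 0%nat) (W 0%nat) - cone_point lam i (V' 0%nat) (W' 0%nat))%C.
Proof.
  intros Hc Hc'. induction q as [|q IH].
  - simpl. ring.
  - destruct (return_time_cover k q) as (n & j & E & Hj).
    destruct (coded_between k V W i n j Hc Hj) as [HA _].
    destruct (coded_between k V' W' i n j Hc' Hj) as [HA' _].
    rewrite <- E in HA, HA'.
    rewrite !iterT_S, (T_on_cone lam _ _ HA), (T_on_cone lam _ _ HA').
    match goal with |- Cmod ?e = _ =>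
      replace e with (- lam * (iterT lam q (cone_point lam i (V 0%nat) (W 0%nat)) -
        iterT lam q (cone_point lam i (V' 0%nat) (W' 0%nat))))%C by ring end.
    rewrite Cmod_mult, IH, Cmod_opp, Cmod_R, Rabs_pos_eq by lra. simpl. ring.
Qed.

(** Points between two returns are off the section, so an orbit can only close up
    at a return time. *)
Lemma coded_return k V W i q : coded k V W ->
  iterT lam q (cone_point lam i (V 0%nat) (W 0%nat)) = cone_point lam i (V 0%nat) (W 0%nat) ->
  exists n, q = return_time k n /\ ((i + n) mod 3 = i mod 3)%nat /\ V n = V 0%nat.
Proof.
  intros Hc E. destruct (return_time_cover k q) as (n & j & -> & Hj).
  destruct (coded_between k V W i n j Hc Hj) as [_ Hoff].
  destruct (Nat.eq_dec j 0) as [->|Hne].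
  - exists n. split; [lia|]. rewrite Nat.add_0_l, (coded_orbit _ _ _ _ _ Hc) in E.
    destruct (Hc n) as ((H1 & H2 & _) & _). destruct (Hc 0%nat) as ((H1' & H2' & _) & _).
    apply cone_point_inj in E; try lra. tauto.
  - specialize (Hoff Hne). rewrite E in Hoff.
    exfalso. revert Hoff. apply not_off_section; trivial. apply Hc.
Qed.

Lemma coded_minimal_period k V W n0 : coded k V W ->
  (0 < n0)%nat -> (n0 mod 3 = 0)%nat -> V n0 = V 0%nat -> W n0 = W 0%nat ->
  (forall n, (0 < n < n0)%nat -> (n mod 3 = 0)%nat -> V n <> V 0%nat) ->
  minimal_period lam (return_time k n0) (cone_point lam 0 (V 0%nat) (W 0%nat)).
Proof.
  intros Hc Hn0 Hmod HV HW Hmin. split; [|split].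
  - now apply (return_time_mono k 0).
  - rewrite (coded_orbit _ _ _ _ _ Hc), HV, HW.
    rewrite (Nat.div_mod_eq n0 3), Hmod, Nat.add_0_r. now apply cone_point_add3.
  - intros q Hq E. destruct (coded_return _ _ _ _ _ Hc E) as (n & -> & Hn & HVn).
    assert (n < n0)%nat.
    { destruct (Nat.lt_ge_cases n n0) as [|Hle]; trivial.
      apply Nat.lt_eq_cases in Hle. destruct Hle as [Hlt| ->]; [|lia].
      apply (return_time_mono k) in Hlt. lia. }
    apply (Hmin n); trivial.
    split; trivial. destruct n; [simpl in Hq; lia|lia].
Qed.

Lemma symbol_le k j V : lam < lam ^ (2 * k + 1) * V -> lam ^ (2 * S j) * V <= 1 ->
  (k <= j)%nat.
Proof.
  intros H1 H2. destruct (Nat.le_gt_cases k j) as [|H]; trivial. exfalso.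
  rewrite !odd_pow in *.
  replace (2 * k)%nat with (2 * (k - S j) + 2 * S j)%nat in H1 by lia.
  rewrite pow_add in H1.
  pose proof (pow_lam_bounds lam Hlam (2 * (k - S j))) as Hp.
  pose proof (pow_lam_bounds lam Hlam (2 * S j)) as Hq.
  set (p := lam ^ (2 * (k - S j))) in *. set (r := lam ^ (2 * S j)) in *.
  assert (E : lam * (p * r) * V = lam * (p * (r * V))) by ring. rewrite E in H1.
  assert (1 < p * (r * V)) by nra. nra.
Qed.

(** The linear part of the return map is, in suitable coordinates, mu times a
    rotation by 60 degrees; in two steps V_n cancels and leaves only W_n, which is confined to (lam, 1/lam).
    This makes the next symbol but one almost a function of two symbols. *)
Lemma coded_second_iterate k V W n : coded k V W ->
  V (S (S n)) = 1 + lam ^ (2 * k (S n) + 1) * (1 - lam ^ (2 * k n + 1) * W n).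
Proof.
  intros Hc. destruct (Hc (S n)) as (_ & _ & _ & -> & _).
  destruct (Hc n) as (_ & _ & _ & -> & ->). ring.
Qed.

(** The bound V' < 1 + 1/lam - lam mu, together with b (lam + 1 - b) <= 1
    for b = lam^3 * lam^(2k), keeps V' below the range of the symbol k + 2. *)
Lemma symbol_step k V W n : coded k V W -> (k (S n) <= S (k n))%nat.
Proof.
  intros Hc. destruct (Hc (S n)) as ((H1 & H2 & H3 & H4) & H5 & H6 & _).
  destruct (Hc n) as ((H1' & H2' & H3' & H4') & H5' & H6' & EV & EW).
  apply (symbol_le _ _ _ H5).
  rewrite !even_pow_S. rewrite EV. rewrite Rmult_minus_distr_l, <- EW.
  rewrite !odd_pow in *. pose proof (pow_lam_bounds lam Hlam (2 * k n)) as Hp.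
  set (p := lam ^ (2 * k n)) in *.
  assert (H7 : lam * (1 + (W (S n) - lam * p * W n)) <= lam + 1 - lam * lam * lam * p) by nra.
  set (b := lam * lam * lam * p).
  assert (Hb : 0 < b) by (repeat apply Rmult_lt_0_compat; lra).
  assert (H8 : b * (lam * (1 + (W (S n) - lam * p * W n))) <= b * (lam + 1 - b))
    by (apply Rmult_le_compat_l; [lra|exact H7]).
  replace (lam * lam * (lam * lam * p) * (1 + (W (S n) - lam * p * W n)))
    with (b * (lam * (1 + (W (S n) - lam * p * W n)))) by (unfold b; ring).
  apply Rle_trans with (1 := H8).
  assert (b * lam <= b) by nra. pose proof (pow2_ge_0 (1 - b)). nra.
Qed.

(** The worst case W n = lam of the second-iterate formula. *)
Lemma symbol_bound k V W n j : coded k V W ->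
  (forall a, a = lam ^ (2 * S (k n)) ->
     lam ^ (2 * S j) * (1 + lam ^ (2 * k (S n) + 1) * (1 - a)) <= 1) ->
  (k (S (S n)) <= j)%nat.
Proof.
  intros Hc Hj. destruct (Hc (S (S n))) as (_ & H5 & _).
  destruct (Hc n) as ((H1 & H2 & H3 & H4) & _).
  apply (symbol_le _ _ _ H5). rewrite (coded_second_iterate _ _ _ _ Hc).
  specialize (Hj _ eq_refl). rewrite (even_pow_S lam (k n)) in Hj.
  eapply Rle_trans; [|exact Hj].
  pose proof (pow_lam_bounds lam Hlam (2 * S j)).
  pose proof (pow_lam_bounds lam Hlam (2 * k (S n) + 1)).
  rewrite (odd_pow lam (k n)).
  pose proof (pow_lam_bounds lam Hlam (2 * k n)).
  apply Rmult_le_compat_l; [lra|]. apply Rplus_le_compat_l.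
  apply Rmult_le_compat_l; [lra|]. set (p := lam ^ (2 * k n)) in *.
  assert (0 < lam * p) by nra. nra.
Qed.

(** With a = lam^(2k+2) the claim is a (1 + lam a (1 - a)) <= 1, that is
    0 <= (1 - a) (1 - lam a^2). *)
Lemma symbol_after_rise k V W n : coded k V W ->
  k (S n) = S (k n) -> (k (S (S n)) <= k n)%nat.
Proof.
  intros Hc E. apply (symbol_bound _ _ _ _ _ Hc). intros a Ha.
  rewrite E, odd_pow, <- Ha.
  assert (0 < a <= 1) by (rewrite Ha; apply pow_lam_bounds; trivial).
  assert (0 <= (1 - a) * (1 - lam * (a * a))).
  { assert (a * a <= 1) by nra. apply Rmult_le_pos; nra. }
  nra.
Qed.

(** With a = lam^(2k+2) the claim is a (1 + (a / lam) (1 - a)) <= 1, that is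
    0 <= (1 - a) (1 - a^2 / lam), which holds since a <= lam. *)
Lemma symbol_after_repeat k V W n : coded k V W ->
  k (S n) = k n -> (k (S (S n)) <= k n)%nat.
Proof.
  intros Hc E. apply (symbol_bound _ _ _ _ _ Hc). intros a Ha.
  rewrite E, odd_pow, <- Ha. rewrite even_pow_S in Ha.
  pose proof (pow_lam_bounds lam Hlam (2 * k n)) as Hp.
  set (p := lam ^ (2 * k n)) in *.
  assert (0 < lam * p <= 1) by nra. rewrite Ha.
  replace (lam * lam * p) with (lam * (lam * p)) by ring.
  set (r := lam * p) in *.
  assert (0 <= (1 - lam * r) * (1 - lam * (r * r))).
  { assert (r * r <= 1) by nra. apply Rmult_le_pos; nra. }
  nra.
Qed.

End Coding.

(** * Eventual patterns *)

Definition alternating (K n : nat) : nat := if Nat.even n then K else S K.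

Lemma nonincreasing_eventually_constant (M : nat -> nat) :
  (forall n, (M (S n) <= M n)%nat) -> exists N, forall n, (N <= n)%nat -> M n = M N.
Proof.
  intros H.
  assert (Hm : forall m n, (n <= m)%nat -> (M m <= M n)%nat).
  { induction 1 as [|m Hm IH]; [lia|]. specialize (H m). lia. }
  remember (M 0%nat) as b eqn:Eb. assert (Hb : exists N, (M N <= b)%nat) by (exists 0%nat; lia).
  clear Eb. induction b as [|b IH].
  - destruct Hb as [N HN]. exists N. intros n Hn. specialize (Hm _ _ Hn). lia.
  - destruct (classic (exists N, (M N <= b)%nat)) as [Hs|Hs]; [now apply IH|].
    destruct Hb as [N HN]. exists N. intros n Hn. specialize (Hm _ _ Hn).
    destruct (Nat.le_gt_cases (M n) b); [exfalso; eauto|]. lia.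
Qed.

(** The rules make max (k n, k (n+1)) nonincreasing, hence eventually a constant K.
    From then on a symbol below K is followed by K, so it equals K - 1 by
    the first rule, and the second rule forces a symbol below K two steps later:
    the alternation never stops. *)
Lemma constant_or_alternating (k : nat -> nat) :
  (forall n, (k (S n) <= S (k n))%nat) ->
  (forall n, k (S n) = S (k n) -> (k (S (S n)) <= k n)%nat) ->
  (forall n, k (S n) = k n -> (k (S (S n)) <= k n)%nat) ->
  exists N K, (forall n, k (N + n)%nat = K) \/ (forall n, k (N + n)%nat = alternating K n).
Proof.
  intros Hs Hr He.
  destruct (nonincreasing_eventually_constant (fun n => Nat.max (k n) (k (S n)))) as [N HN].
  { intros n. pose proof (Hs n). pose proof (Hs (S n)). specialize (He n). specialize (Hr n).
    lia. }
  set (K := Nat.max (k N) (k (S N))) in *.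
  assert (HK : forall n, (N <= n)%nat -> Nat.max (k n) (k (S n)) = K) by exact HN.
  clear HN.
  destruct (classic (forall n, k (N + n)%nat = K)) as [H|H]; [eauto|].
  apply not_all_ex_not in H. destruct H as [n Hn].
  exists (N + n)%nat, (K - 1)%nat. right.
  assert (Hlow : forall m, (N <= m)%nat -> k m <> K ->
            S (k m) = K /\ k (S m) = K /\ k (S (S m)) <> K).
  { intros m Hm Hne. pose proof (HK m Hm) as H1. pose proof (Hs m). specialize (Hr m).
    lia. }
  assert (Hall : forall j, k (N + n + 2 * j)%nat <> K).
  { induction j as [|j IH]; [now rewrite Nat.add_0_r|].
    replace (N + n + 2 * S j)%nat with (S (S (N + n + 2 * j))) by lia.
    apply Hlow; [lia|trivial]. }
  intros m. unfold alternating.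
  destruct (Nat.Even_or_Odd m) as [[j ->]|[j ->]].
  - replace (Nat.even (2 * j)) with true by (now rewrite Nat.even_mul).
    specialize (Hlow (N + n + 2 * j)%nat ltac:(lia) (Hall j)). lia.
  - replace (Nat.even (2 * j + 1)) with false by (now rewrite Nat.even_add, Nat.even_mul).
    specialize (Hlow (N + n + 2 * j)%nat ltac:(lia) (Hall j)).
    replace (N + n + (2 * j + 1))%nat with (S (N + n + 2 * j)) by lia. lia.
Qed.

Section Normal.
Variable lam : R.
Hypothesis Hlam : 0 < lam < 1.

Lemma symbol_exists i V W : in_section lam V W -> nonsingular lam (cone_point lam i V W) ->
  exists k, lam < lam ^ (2 * k + 1) * V /\ lam * (lam ^ (2 * k + 1) * V) < 1.
Proof.
  intros (HV & HW & HlW & HWl) Hz.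
  destruct (descent lam Hlam (i + 1) (1 + lam * (V - W)) (lam * V)) as (j & H1 & H2);
    try nra.
  { rewrite <- T_next_cone by trivial. apply (nonsingular_iter lam Hlam 1 _ Hz). }
  exists j. rewrite odd_pow.
  replace (lam * lam ^ (2 * j) * V) with (lam ^ (2 * j) * (lam * V)) by ring. now split.
Qed.

(** The symbol is a function of the current V, so the coding can be produced by
    iterating one map; non-singularity provides a symbol at each return. *)
Lemma nonsingular_coded z : nonsingular lam z ->
  exists t i k V W, coded lam k V W /\ iterT lam t z = cone_point lam i (V 0%nat) (W 0%nat).
Proof.
  intros Hz. destruct (reaches_section lam Hlam z Hz) as (t & i & V0 & W0 & Hs0 & E0).
  pose (symb := fun V => epsilon (inhabits 0%nat) (fun k =>
    lam < lam ^ (2 * k + 1) * V /\ lam * (lam ^ (2 * k + 1) * V) < 1)).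
  pose (state := fun n => Nat.iter n (fun s : R * R =>
    (1 + lam ^ (2 * symb (fst s) + 1) * (fst s - snd s),
     lam ^ (2 * symb (fst s) + 1) * fst s)) (V0, W0)).
  assert (Hsymb : forall i V W, in_section lam V W -> nonsingular lam (cone_point lam i V W) ->
    lam < lam ^ (2 * symb V + 1) * V /\ lam * (lam ^ (2 * symb V + 1) * V) < 1).
  { intros j V W Hs Hn. unfold symb. apply epsilon_spec. eapply symbol_exists; eauto. }
  assert (Hinv : forall n, in_section lam (fst (state n)) (snd (state n)) /\
            nonsingular lam (cone_point lam (i + n) (fst (state n)) (snd (state n)))).
  { induction n as [|n [IHs IHn]].
    - split; [exact Hs0|]. simpl. rewrite Nat.add_0_r, <- E0. now apply nonsingular_iter.
    - destruct (Hsymb _ _ _ IHs IHn) as [H1 H2]. split.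
      + now apply next_in_section.
      + destruct (excursion lam Hlam (i + n) _ _ _ IHs H1 H2) as [E _].
        replace (i + S n)%nat with (i + n + 1)%nat by lia.
        change (nonsingular lam (cone_point lam (i + n + 1)
          (1 + lam ^ (2 * symb (fst (state n)) + 1) * (fst (state n) - snd (state n)))
          (lam ^ (2 * symb (fst (state n)) + 1) * fst (state n)))).
        rewrite <- E. now apply nonsingular_iter. }
  exists t, i, (fun n => symb (fst (state n))), (fun n => fst (state n)), (fun n => snd (state n)).
  split; [|exact E0]. intros n. destruct (Hinv n) as [Hs Hn].
  destruct (Hsymb _ _ _ Hs Hn) as [H1 H2]. repeat split; trivial; apply Hs.
Qed.

Lemma coded_shift k V W m : coded lam k V W ->
  coded lam (fun n => k (m + n)%nat) (fun n => V (m + n)%nat) (fun n => W (m + n)%nat).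
Proof.
  intros Hc n. replace (m + S n)%nat with (S (m + n)) by lia. apply (Hc (m + n)%nat).
Qed.

Lemma coded_ext k k' V W : (forall n, k n = k' n) -> coded lam k V W -> coded lam k' V W.
Proof. intros E Hc n. rewrite <- E. apply Hc. Qed.

(** Both the phase of the pattern and the cone can be normalised by waiting:
    2 (i + N) further returns keep the parity and bring the cone index i + N to
    3 (i + N), that is, to the cone 0. *)
Lemma nonsingular_normal_form z : nonsingular lam z ->
  exists t K V W, iterT lam t z = cone_point lam 0 (V 0%nat) (W 0%nat) /\
    (coded lam (fun _ => K) V W \/ coded lam (alternating K) V W).
Proof.
  intros Hz. destruct (nonsingular_coded z Hz) as (t & i & k & V & W & Hc & E).
  destruct (constant_or_alternating k) as (N & K & Hk).
  { intros n. eapply symbol_step; eauto. }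
  { intros n. eapply symbol_after_rise; eauto. }
  { intros n. eapply symbol_after_repeat; eauto. }
  pose (m := (N + 2 * (i + N))%nat).
  exists (return_time k m + t)%nat, K, (fun n => V (m + n)%nat), (fun n => W (m + n)%nat).
  split.
  - rewrite iterT_add, E, (coded_orbit lam Hlam k V W i m Hc), !Nat.add_0_r.
    replace (i + m)%nat with (0 + 3 * (i + N))%nat by (unfold m; lia). apply cone_point_add3.
  - pose proof (coded_shift _ _ _ m Hc) as Hm.
    destruct Hk as [Hk|Hk]; [left|right]; revert Hm; apply coded_ext; intros n;
      unfold m; rewrite <- Nat.add_assoc, Hk; trivial.
    unfold alternating. now rewrite Nat.even_add, Nat.even_mul; destruct (Nat.even n).
Qed.

(** * Realising the constant and the alternating pattern *)

Lemma succ_odd_pow K : lam ^ (2 * K + 2) = lam * lam ^ (2 * K + 1).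
Proof. now replace (2 * K + 2)%nat with (S (2 * K + 1)) by lia. Qed.

(** Three returns give W_3 + mu^3 W_0 = mu + mu^2, since the cube of a rotation
    by 60 degrees is -1.  Both W_0 and W_3 exceed lam, and 1 + mu^3 is divisible
    by 1 + mu. *)
Lemma coded_constant_admissible K V W : coded lam (fun _ => K) V W ->
  let mu := lam ^ (2 * K + 1) in lam * (1 - mu + mu ^ 2) < mu.
Proof.
  intros Hc mu.
  assert (E : W 3%nat = mu * (1 + mu * (1 - mu * W 0%nat))).
  { pose proof (coded_second_iterate lam _ V W 0 Hc) as E2. cbv beta in E2.
    destruct (Hc 2%nat) as (_ & _ & _ & _ & ->). now rewrite E2. }
  destruct (Hc 0%nat) as ((_ & _ & H0 & _) & _).
  destruct (Hc 3%nat) as ((_ & _ & H3 & _) & _).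
  assert (Hmu : 0 < mu <= 1) by (apply pow_lam_bounds; trivial).
  assert (H : lam * (1 + mu * (mu * mu)) < mu * (1 + mu)).
  { assert (0 < mu * (mu * mu)) by (repeat apply Rmult_lt_0_compat; lra). nra. }
  apply Rmult_lt_reg_r with (1 + mu); [lra|]. lra.
Qed.

(** At the fixed point of (V, W) |-> (1 + mu (V - W), mu V), every inequality of
    an orbit follows from 0 < mu < 1 except lam < W, which is the hypothesis. *)
Lemma coded_constant K : let mu := lam ^ (2 * K + 1) in
  lam * (1 - mu + mu ^ 2) < mu ->
  coded lam (fun _ => K) (fun _ => / (1 - mu + mu ^ 2)) (fun _ => mu * / (1 - mu + mu ^ 2)).
Proof.
  intros mu H n. fold mu.
  assert (Hmu : 0 < mu < 1).
  { unfold mu. rewrite odd_pow. pose proof (pow_lam_bounds lam Hlam (2 * K)). nra. }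
  assert (HD : 0 < 1 - mu + mu ^ 2) by nra.
  assert (HV : 0 < / (1 - mu + mu ^ 2)) by now apply Rinv_0_lt_compat.
  assert (HI : (1 - mu + mu ^ 2) * / (1 - mu + mu ^ 2) = 1) by (apply Rinv_r; lra).
  set (D := 1 - mu + mu ^ 2) in *. set (U := / D) in *.
  assert (HD1 : D < 1) by (unfold D; nra).
  assert (HDm : lam * mu < D) by (unfold D; nra).
  assert (H1 : 1 < U) by nra.
  assert (H2 : mu * U < U) by nra.
  assert (H3 : lam < mu * U) by (apply Rmult_lt_compat_r with (r := U) in H; [nra|lra]).
  assert (H4 : lam * (mu * U) < 1) by (apply Rmult_lt_compat_r with (r := U) in HDm; nra).
  unfold in_section. repeat split; trivial.
  clearbody U. unfold D in HI. lra.
Qed.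

(** Two returns have the linear part a^2 R, where R is conjugate to a rotation by
    120 degrees, so that 1 + R + R^2 = 0 and W_4 + a^2 W_2 + a^4 W_0 is constant.
    All three values exceed lam. *)
Lemma coded_alternating_admissible K V W : coded lam (alternating K) V W ->
  let a := lam ^ (2 * K + 2) in lam * (1 - a + a ^ 2 - a ^ 3 + a ^ 4) < a ^ 2.
Proof.
  intros Hc a. set (mu := lam ^ (2 * K + 1)).
  assert (Ea : a = lam * mu) by apply succ_odd_pow.
  assert (Hs : forall n, (n = 0 \/ n = 2)%nat -> W (S (S n)) =
            lam ^ 2 * mu * (1 + mu * (V n - W n))).
  { intros n Hn.
    assert (alternating K n = K /\ alternating K (S n) = S K) as [E1 E2]
      by (destruct Hn; subst n; split; reflexivity).
    destruct (Hc n) as (_ & _ & _ & EV & _). destruct (Hc (S n)) as (_ & _ & _ & _ & EW).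
    rewrite EW, EV, E1, E2. unfold mu. rewrite !odd_pow, even_pow_S. ring. }
  assert (Hv : V 2%nat = 1 + lam ^ 2 * mu * (1 - mu * W 0%nat)).
  { rewrite (coded_second_iterate lam _ V W 0 Hc). unfold mu. cbn [alternating Nat.even].
    change (alternating K 0) with K. change (alternating K 1) with (S K).
    rewrite !odd_pow, even_pow_S. ring. }
  pose proof (Hs 0%nat ltac:(auto)) as E2. pose proof (Hs 2%nat ltac:(auto)) as E4.
  rewrite Hv in E4.
  destruct (Hc 0%nat) as ((_ & _ & H0 & _) & _).
  destruct (Hc 2%nat) as ((_ & _ & H2 & _) & _).
  destruct (Hc 4%nat) as ((_ & _ & H4 & _) & _).
  assert (Hmu : 0 < mu <= 1) by (apply pow_lam_bounds; trivial).
  assert (Hrel : W 4%nat + a ^ 2 * W 2%nat + a ^ 4 * W 0%nat =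
                 lam * a + lam * a ^ 3 + a ^ 2).
  { rewrite E4, Ea. ring. }
  assert (0 < a) by (rewrite Ea; nra).
  assert (0 < a ^ 2) by now apply pow_lt. assert (0 < a ^ 4) by now apply pow_lt.
  nra.
Qed.

(** The 2-cycle of the return map with the symbols K, K+1, obtained by solving
    V_(n+2) = V_n in the second-iterate formula. *)
Definition cycle_V (K n : nat) : R :=
  let mu := lam ^ (2 * K + 1) in
  let a := lam * mu in
  (1 + a ^ 2 + (if Nat.even n then lam * a else mu)) * / (1 + a ^ 2 + a ^ 4).

Definition cycle_W (K n : nat) : R :=
  let mu := lam ^ (2 * K + 1) in
  (if Nat.even n then lam ^ 2 * mu else mu) * cycle_V K (S n).

(** The hypothesis is lam < W at even times; the other inequalities follow from
    it or hold for all lam. *)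
Lemma coded_alternating K : let a := lam ^ (2 * K + 2) in
  lam * (1 - a + a ^ 2 - a ^ 3 + a ^ 4) < a ^ 2 ->
  coded lam (alternating K) (cycle_V K) (cycle_W K).
Proof.
  intros a0 H. unfold a0 in H.
  rewrite succ_odd_pow in H.
  clear a0. intros n. unfold cycle_W, cycle_V, alternating.
  rewrite !Nat.even_succ_succ, !Nat.even_succ, <- !Nat.negb_even.
  assert (E3 : lam ^ (2 * S K + 1) = lam ^ 2 * lam ^ (2 * K + 1))
    by (rewrite !odd_pow, even_pow_S; ring).
  assert (Hmu : 0 < lam ^ (2 * K + 1) <= lam).
  { rewrite odd_pow. pose proof (pow_lam_bounds lam Hlam (2 * K)). nra. }
  set (mu := lam ^ (2 * K + 1)) in *.
  set (a := lam * mu) in *.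
  assert (Ha : 0 < a < mu) by (unfold a; nra).
  assert (Ha2 : 0 < a ^ 2 < a) by nra.
  assert (Ha3 : 0 < a ^ 3 < a ^ 2) by nra.
  assert (Ha4 : 0 < a ^ 4 < a ^ 3) by nra.
  assert (Hpos : 0 <= (1 - a) * (1 - a ^ 3)) by (apply Rmult_le_pos; lra).
  set (D := 1 + a ^ 2 + a ^ 4) in *.
  assert (HU : 0 < / D) by (apply Rinv_0_lt_compat; unfold D; lra).
  assert (HI : D * / D = 1) by (apply Rinv_r; unfold D; lra).
  set (U := / D) in *. clearbody U.
  assert (Hlow : forall x y, x * D < y -> x < y * U).
  { intros x y Hxy. apply Rmult_lt_compat_r with (r := U) in Hxy; [|trivial].
    rewrite Rmult_assoc, HI in Hxy. lra. }
  assert (Hupp : forall x y, y < x * D -> y * U < x).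
  { intros x y Hxy. apply Rmult_lt_compat_r with (r := U) in Hxy; [|trivial].
    rewrite (Rmult_assoc x), HI in Hxy. lra. }
  assert (Emu : lam ^ 2 * mu = lam * a) by (unfold a; ring).
  set (Ve := (1 + a ^ 2 + lam * a) * U). set (Vo := (1 + a ^ 2 + mu) * U).
  assert (HVe : 1 < Ve) by (apply Hlow; unfold D; nra).
  assert (HVo : 1 < Vo) by (apply Hlow; unfold D; nra).
  assert (EWe : lam ^ 2 * mu * Vo = (lam * a + lam * a ^ 3 + a ^ 2) * U)
    by (unfold Vo, a; ring).
  assert (EWo : mu * Ve = (mu + mu * a ^ 2 + a ^ 2) * U) by (unfold Ve, a; ring).
  assert (HWe : lam < lam ^ 2 * mu * Vo) by (rewrite EWe; apply Hlow; unfold D; lra).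
  assert (HWe' : lam * (lam ^ 2 * mu * Vo) < 1).
  { rewrite EWe, <- Rmult_assoc. apply Hupp. unfold D.
    assert (lam * (lam * a) < a) by nra. assert (lam * (lam * a ^ 3) < a ^ 3) by nra. nra. }
  (* The lower bound at odd times follows from the one at even times times lam. *)
  assert (HWo : lam < mu * Ve).
  { rewrite EWo. apply Hlow. apply Rmult_lt_reg_l with lam; [lra|].
    replace (lam * (mu + mu * a ^ 2 + a ^ 2)) with (a + a ^ 3 + lam * a ^ 2)
      by (unfold a; ring).
    assert (lam * (lam * D) < lam * (lam * a + lam * a ^ 3 + a ^ 2))
      by (apply Rmult_lt_compat_l; unfold D; lra).
    assert (lam * (lam * a) < a) by nra. assert (lam * (lam * a ^ 3) < a ^ 3) by nra. lra. }
  assert (HWo' : lam * (mu * Ve) < 1).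
  { rewrite EWo, <- Rmult_assoc. apply Hupp.
    replace (lam * (mu + mu * a ^ 2 + a ^ 2)) with (a + a ^ 3 + lam * a ^ 2)
      by (unfold a; ring). unfold D. nra. }
  assert (HWVe : lam ^ 2 * mu * Vo < Ve).
  { rewrite EWe. unfold Ve. apply Rmult_lt_compat_r; [trivial|]. nra. }
  assert (HWVo : mu * Ve < Vo).
  { rewrite EWo. unfold Vo. apply Rmult_lt_compat_r; [trivial|]. nra. }
  destruct (Nat.even n); simpl negb; cbv iota; rewrite ?E3; fold Ve Vo; fold mu;
    unfold in_section; repeat split; trivial.
  - transitivity (D * U + mu * (Ve - lam ^ 2 * mu * Vo)); [|now rewrite HI].
    unfold Ve, Vo, D, a. ring.
  - transitivity (D * U + lam ^ 2 * mu * (Vo - mu * Ve)); [|now rewrite HI].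
    unfold Ve, Vo, D, a. ring.
Qed.

End Normal.

(** * Sign changes of the threshold polynomials *)

Fixpoint geo (n : nat) (x : R) : R :=
  match n with 0%nat => 0 | S n => geo n x + x ^ n end.

Lemma geo_eq n x : (1 - x) * geo n x = 1 - x ^ n.
Proof. induction n as [|n IH]; simpl; [ring|]. rewrite Rmult_plus_distr_l, IH. ring. Qed.

Lemma geo_at_1 n : geo n 1 = INR n.
Proof.
  induction n as [|n IH]; [reflexivity|].
  cbn [geo]. rewrite IH, pow1, S_INR. reflexivity.
Qed.

Lemma geo_S_pos n x : 0 <= x -> 1 <= geo (S n) x.
Proof.
  intros Hx. induction n as [|n IH]; [simpl; lra|].
  change (1 <= geo (S n) x + x ^ S n). pose proof (pow_le x (S n) Hx). lra.
Qed.

Lemma geo_at_0 n : geo (S n) 0 = 1.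
Proof.
  induction n as [|n IH]; [simpl; ring|].
  change (geo (S n) 0 + 0 ^ S n = 1). rewrite IH. simpl. ring.
Qed.

Lemma geo_increasing n x y : 0 <= x < y -> geo (S (S n)) x < geo (S (S n)) y.
Proof.
  intros Hxy. induction n as [|n IH]; [simpl; lra|].
  change (geo (S (S n)) x + x ^ S (S n) < geo (S (S n)) y + y ^ S (S n)).
  assert (x ^ S (S n) <= y ^ S (S n)) by (apply pow_incr; lra). lra.
Qed.

(** geo (n+1) x / x^n is the sum of x^(-j) over j <= n, so it does not increase with x. *)
Lemma geo_ratio n x y : 0 <= x <= y -> geo (S n) y * x ^ n <= geo (S n) x * y ^ n.
Proof.
  intros Hxy. induction n as [|n IH]; [simpl; lra|].
  change ((geo (S n) y + y ^ S n) * (x * x ^ n) <= (geo (S n) x + x ^ S n) * (y * y ^ n)).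
  pose proof (geo_S_pos n x ltac:(lra)).
  assert (0 <= geo (S n) x * y ^ n)
    by (apply Rmult_le_pos; [lra|apply pow_le; lra]).
  replace ((geo (S n) y + y ^ S n) * (x * x ^ n))
    with (x * (geo (S n) y * x ^ n) + x ^ S n * y ^ S n) by (simpl; ring).
  replace ((geo (S n) x + x ^ S n) * (y * y ^ n))
    with (y * (geo (S n) x * y ^ n) + x ^ S n * y ^ S n) by (simpl; ring).
  nra.
Qed.

Lemma continuity_pow n : continuity (fun x => x ^ n).
Proof. apply derivable_continuous, derivable_pow. Qed.

Lemma continuity_geo n : continuity (geo n).
Proof.
  induction n as [|n IH].
  - apply continuity_const. intros x y. reflexivity.
  - apply (continuity_plus (geo n) (fun x => x ^ n)); trivial. apply continuity_pow.
Qed.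

(** Dividing f by 1 - x removes the root at 1.  The quotient h has
    a zero by the intermediate value theorem; being negative ever after it is once
    nonpositive, it has no other zero and is negative exactly to the right of it. *)
Lemma selected_root_threshold (f h : R -> R) :
  (forall x, f x = (1 - x) * h x) -> continuity h -> 0 <= h 0 -> h 1 < 0 ->
  (forall x y, 0 <= x < y -> y < 1 -> h x <= 0 -> h y < 0) ->
  forall x, 0 < x < 1 ->
    (epsilon (inhabits 0) (fun r => 0 <= r < 1 /\ f r = 0) < x <-> f x < 0).
Proof.
  intros Hf Hc H0 H1 Hcross x Hx.
  assert (Hex : exists r, 0 <= r < 1 /\ f r = 0).
  { destruct (IVT_cor h 0 1 Hc) as (r & Hr & Er); [lra|nra|].
    exists r. rewrite Hf, Er. split; [|ring].
    destruct (Req_dec r 1) as [->|]; lra. }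
  apply epsilon_spec with (i := inhabits 0) in Hex.
  set (r := epsilon (inhabits 0) _) in *. destruct Hex as [Hr Er].
  rewrite Hf in Er |- *.
  assert (Ehr : h r = 0) by (apply Rmult_integral in Er; destruct Er; lra).
  split; intros H.
  - assert (h x < 0) by (apply (Hcross r x); lra). nra.
  - destruct (Rlt_le_dec r x) as [|Hle]; trivial. exfalso.
    assert (Hhx : h x < 0) by nra.
    destruct (Req_dec x r) as [E|Hne]; [rewrite E in Hhx; lra|].
    assert (h r < 0) by (apply (Hcross x r); lra). lra.
Qed.

Definition lambda_poly (n : nat) (x : R) : R := x ^ (2 * n) - x ^ n - x ^ (n - 1) + 1.
Definition gamma_poly (n : nat) (x : R) : R :=
  x ^ (4 * n + 4) - x ^ (3 * n + 3) + x ^ (2 * n + 2) - x ^ (2 * n + 1)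
      - x ^ (n + 1) + 1.

(** The quotient by 1 - x is S_n - x^(n-1) S_(n+1), where S_n is the geometric sum:
    S_n / x^(n-1) does not increase while S_(n+1) increases. *)
Lemma lambda_threshold n x : (1 <= n)%nat -> 0 < x < 1 ->
  (lambda_seq n < x <-> lambda_poly n x < 0).
Proof.
  intros Hn Hx. destruct n as [|m]; [lia|].
  apply (selected_root_threshold (lambda_poly (S m))
    (fun x => geo (S m) x - x ^ m * geo (S (S m)) x)); trivial.
  - intros y. unfold lambda_poly. rewrite Rmult_minus_distr_l.
    replace ((1 - y) * (y ^ m * geo (S (S m)) y))
      with (y ^ m * ((1 - y) * geo (S (S m)) y)) by ring.
    rewrite !geo_eq. replace (2 * S m)%nat with (m + S (S m))%nat by lia.
    replace (S m - 1)%nat with m by lia. rewrite pow_add. ring.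
  - apply (continuity_minus (geo (S m)) (fun x => x ^ m * geo (S (S m)) x)).
    + apply continuity_geo.
    + apply (continuity_mult (fun x => x ^ m) (geo (S (S m)))).
      * apply continuity_pow.
      * apply continuity_geo.
  - rewrite !geo_at_0. destruct m; simpl; lra.
  - rewrite !geo_at_1, pow1, (S_INR (S m)). lra.
  - intros a b Hab Hb H.
    pose proof (geo_ratio m a b ltac:(lra)) as H1.
    pose proof (geo_increasing m a b Hab) as H2.
    pose proof (geo_S_pos m a ltac:(lra)) as H3.
    pose proof (geo_S_pos (S m) a ltac:(lra)) as H4.
    pose proof (pow_le a m ltac:(lra)) as Ha.
    pose proof (pow_lt b m ltac:(lra)) as Hbm.
    assert (Ha' : 0 < a ^ m).
    { destruct Ha as [|Ha]; trivial. rewrite <- Ha in H. lra. }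
    assert (H5 : geo (S m) b * a ^ m < a ^ m * geo (S (S m)) b * b ^ m).
    { apply Rle_lt_trans with (1 := H1).
      apply Rmult_lt_compat_r; [trivial|]. nra. }
    apply Rmult_lt_reg_r with (a ^ m); trivial. lra.
Qed.

(** With N = n + 1 the quotient by 1 - x is S_N (1 - x^(3N)) - x^(2N-1): after division by
    x^(N-1), the first term is a product of positive factors, one nonincreasing
    and one decreasing, whereas the second term becomes x^N. *)
Lemma gamma_threshold n x : 0 < x < 1 ->
  (gamma_seq n < x <-> gamma_poly n x < 0).
Proof.
  intros Hx.
  apply (selected_root_threshold (gamma_poly n)
    (fun x => geo (S n) x * (1 - x ^ (3 * n + 3)) - x ^ (2 * n + 1))); trivial.
  - intros y. unfold gamma_poly. rewrite Rmult_minus_distr_l, <- Rmult_assoc, geo_eq.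
    replace (4 * n + 4)%nat with (S n + (3 * n + 3))%nat by lia.
    replace (2 * n + 2)%nat with (S (2 * n + 1)) by lia.
    replace (n + 1)%nat with (S n) by lia. rewrite pow_add. simpl. ring.
  - apply (continuity_minus (fun x => geo (S n) x * (1 - x ^ (3 * n + 3)))
      (fun x => x ^ (2 * n + 1))); [|apply continuity_pow].
    apply (continuity_mult (geo (S n)) (fun x => 1 - x ^ (3 * n + 3)));
      [apply continuity_geo|].
    apply (continuity_minus (fun _ => 1) (fun x => x ^ (3 * n + 3)));
      [|apply continuity_pow].
    apply continuity_const. intros a b. reflexivity.
  - rewrite geo_at_0, !pow_i by lia. lra.
  - rewrite !pow1. lra.
  - intros a b Hab Hb H.
    pose proof (geo_ratio n a b ltac:(lra)) as H1.
    pose proof (geo_S_pos n a ltac:(lra)) as H3.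
    pose proof (pow_le a n ltac:(lra)) as Ha.
    pose proof (pow_lt b n ltac:(lra)) as Hbn.
    assert (Hcube : forall x, x ^ (3 * n + 3) = x ^ S n * x ^ S n * x ^ S n).
    { intros y. rewrite <- !pow_add. f_equal. lia. }
    assert (Hsplit : forall x, x ^ (2 * n + 1) = x ^ n * x ^ S n).
    { intros y. rewrite <- !pow_add. f_equal. lia. }
    rewrite Hcube, Hsplit in *.
    assert (Hpow : 0 <= a ^ S n < b ^ S n /\ b ^ S n < 1).
    { split; [split|].
      - apply pow_le; lra.
      - assert (a ^ n <= b ^ n) by (apply pow_incr; lra). simpl. nra.
      - apply pow_lt_1_compat; lra || lia. }
    set (p := a ^ S n) in *. set (q := b ^ S n) in *.
    assert (Hc : p * p * p < q * q * q).
    { assert (p * p < q * q) by nra. nra. }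
    assert (Hq : q * q * q < 1) by (assert (q * q < 1) by nra; nra).
    assert (Ha' : 0 < a ^ n).
    { destruct Ha as [|Ha]; trivial. exfalso. rewrite <- Ha in H. nra. }
    apply Rmult_lt_reg_r with (a ^ n); trivial. rewrite Rmult_0_l.
    assert (S1 : geo (S n) b * a ^ n * (1 - q * q * q) <= geo (S n) a * b ^ n * (1 - q * q * q))
      by (apply Rmult_le_compat_r; lra).
    assert (S2 : geo (S n) a * (1 - q * q * q) * b ^ n < a ^ n * q * b ^ n).
    { apply Rmult_lt_compat_r; trivial. nra. }
    lra.
Qed.

(** * Counting the admissible patterns *)

Section Index.
Variable lam : R.
Hypothesis Hlam : 0 < lam < 1.

Lemma pow_nonincreasing m n : (m <= n)%nat -> 0 < lam ^ n <= lam ^ m.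
Proof.
  intros H. replace n with ((n - m) + m)%nat by lia. rewrite pow_add.
  pose proof (pow_lam_bounds lam Hlam (n - m)). pose proof (pow_lam_bounds lam Hlam m).
  split; nra.
Qed.

Lemma lambda_poly_odd K : let mu := lam ^ (2 * K + 1) in
  lam * lambda_poly (2 * K + 1) lam = lam * (1 - mu + mu ^ 2) - mu.
Proof.
  intros mu. unfold lambda_poly.
  replace (2 * K + 1 - 1)%nat with (2 * K)%nat by lia.
  replace (2 * (2 * K + 1))%nat with ((2 * K + 1) + (2 * K + 1))%nat by lia.
  rewrite pow_add. fold mu. unfold mu. rewrite odd_pow. ring.
Qed.

Lemma gamma_poly_odd K : let a := lam ^ (2 * K + 2) in
  lam * gamma_poly (2 * K + 1) lam = lam * (1 - a + a ^ 2 - a ^ 3 + a ^ 4) - a ^ 2.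
Proof.
  intros a. unfold gamma_poly. unfold a.
  rewrite <- !pow_mult.
  replace (4 * (2 * K + 1) + 4)%nat with ((2 * K + 2) * 4)%nat by lia.
  replace (3 * (2 * K + 1) + 3)%nat with ((2 * K + 2) * 3)%nat by lia.
  replace (2 * (2 * K + 1) + 2)%nat with ((2 * K + 2) * 2)%nat by lia.
  replace (2 * K + 1 + 1)%nat with (2 * K + 2)%nat by lia.
  replace ((2 * K + 2) * 2)%nat with (S (2 * (2 * K + 1) + 1)) by lia. 
  rewrite <- tech_pow_Rmult. ring.
Qed.

Lemma lambda_admissible K :
  lambda_seq (2 * K + 1) < lam <->
  (let mu := lam ^ (2 * K + 1) in lam * (1 - mu + mu ^ 2) < mu).
Proof.
  rewrite lambda_threshold by (trivial; lia). pose proof (lambda_poly_odd K) as E.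
  cbv zeta in *. split; intros H; nra.
Qed.

Lemma gamma_admissible K :
  gamma_seq (2 * K + 1) < lam <->
  (let a := lam ^ (2 * K + 2) in lam * (1 - a + a ^ 2 - a ^ 3 + a ^ 4) < a ^ 2).
Proof.
  rewrite gamma_threshold by trivial. pose proof (gamma_poly_odd K) as E.
  cbv zeta in *. split; intros H; nra.
Qed.

(** The inequality reads lam (1 - mu)^2 < mu (1 - lam), which is the
    weaker the larger mu is. *)
Lemma lambda_admissible_down K L : (K <= L)%nat ->
  lambda_seq (2 * L + 1) < lam -> lambda_seq (2 * K + 1) < lam.
Proof.
  rewrite !lambda_admissible. intros HKL.
  pose proof (pow_nonincreasing (2 * K + 1) (2 * L + 1) ltac:(lia)) as H1.
  assert (H2 : lam ^ (2 * K + 1) < 1).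
  { rewrite odd_pow. pose proof (pow_lam_bounds lam Hlam (2 * K)). nra. }
  cbv zeta. set (a := lam ^ (2 * L + 1)) in *. set (b := lam ^ (2 * K + 1)) in *.
  intros H. assert ((1 - b) ^ 2 <= (1 - a) ^ 2) by (apply pow_incr; lra).
  assert (a * (1 - lam) <= b * (1 - lam)) by (apply Rmult_le_compat_r; lra).
  nra.
Qed.

(** The inequality reads lam (1 - a) (1 - a^3) < a^2 (1 - lam), which is the
    weaker the larger a is. *)
Lemma gamma_admissible_down K L : (K <= L)%nat ->
  gamma_seq (2 * L + 1) < lam -> gamma_seq (2 * K + 1) < lam.
Proof.
  rewrite !gamma_admissible. intros HKL.
  pose proof (pow_nonincreasing (2 * K + 2) (2 * L + 2) ltac:(lia)) as H1.
  assert (H2 : lam ^ (2 * K + 2) < 1) by (apply pow_lt_1_compat; lra || lia).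
  cbv zeta. set (a := lam ^ (2 * L + 2)) in *. set (b := lam ^ (2 * K + 2)) in *.
  intros H.
  assert (a ^ 3 <= b ^ 3) by (apply pow_incr; lra).
  assert (b ^ 3 < 1) by (apply pow_lt_1_compat; lra || lia).
  assert (a ^ 2 <= b ^ 2) by (apply pow_incr; lra).
  assert (H5 : (1 - b) * (1 - b ^ 3) <= (1 - a) * (1 - a ^ 3)) by (apply Rmult_le_compat; lra).
  assert (a ^ 2 * (1 - lam) <= b ^ 2 * (1 - lam)) by (apply Rmult_le_compat_r; lra).
  assert (lam * ((1 - b) * (1 - b ^ 3)) <= lam * ((1 - a) * (1 - a ^ 3)))
    by (apply Rmult_le_compat_l; lra).
  lra.
Qed.

Lemma lambda_admissible_bounded : exists K, ~ lambda_seq (2 * K + 1) < lam.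
Proof.
  destruct (pow_lam_small lam Hlam (1 / 2)) as [K HK]; [lra|]. exists K.
  rewrite lambda_admissible. rewrite odd_pow. cbv zeta.
  pose proof (pow_lam_bounds lam Hlam (2 * K)). set (p := lam ^ (2 * K)) in *.
  intros H'. assert (1 - lam * p + (lam * p) ^ 2 < p) by nra. nra.
Qed.

Lemma gamma_admissible_bounded : exists K, ~ gamma_seq (2 * K + 1) < lam.
Proof.
  destruct (pow_lam_small lam Hlam (1 / 2)) as [K HK]; [lra|]. exists K.
  rewrite gamma_admissible. rewrite succ_odd_pow, odd_pow. cbv zeta.
  pose proof (pow_lam_bounds lam Hlam (2 * K)). set (p := lam ^ (2 * K)) in *.
  set (a := lam * (lam * p)).
  (* The admissibility inequality fails as soon as a < 1/2 and a < lam. *)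
  assert (Ha : 0 < a < 1 / 2) by (assert (0 < lam * p < 1 / 2) by nra; unfold a; nra).
  assert (Ha' : a ^ 2 < lam * a).
  { assert (a < lam) by (unfold a; nra). nra. }
  assert (Hpos : 0 <= a ^ 4 + a ^ 2) by nra.
  assert (a ^ 3 < a ^ 2) by nra.
  intros H'. assert (1 - a + a ^ 2 - a ^ 3 + a ^ 4 < a) by nra. nra.
Qed.

(** The K with s (2K+1) < lam form a nonempty bounded initial segment, and its
    length is the only n whose two bounds can enclose lam. *)
Lemma selected_index_spec (s : nat -> R) :
  (forall K L, (K <= L)%nat -> s (2 * L + 1)%nat < lam -> s (2 * K + 1)%nat < lam) ->
  s 1%nat < lam -> (exists K, ~ s (2 * K + 1)%nat < lam) ->
  forall i, (1 <= i)%nat ->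
    ((i <= epsilon (inhabits 0%nat) (fun n : nat => (1 <= n)%nat /\
        (s (2 * n - 1)%nat < lam <= s (2 * n + 1)%nat)%R))%nat <->
     s (2 * (i - 1) + 1)%nat < lam).
Proof.
  intros Hdown H1 [K HK] i Hi.
  assert (Hex : exists n : nat, (1 <= n)%nat /\
        s (2 * n - 1)%nat < lam <= s (2 * n + 1)%nat).
  { revert HK. induction K as [|K IH]; intros HK; [easy|].
    destruct (Rlt_dec (s (2 * K + 1)%nat) lam) as [H|H]; [|auto].
    exists (S K). split; [lia|]. replace (2 * S K - 1)%nat with (2 * K + 1)%nat by lia.
    lra. }
  apply epsilon_spec with (i := inhabits 0%nat) in Hex.
  set (n := epsilon (inhabits 0%nat) _) in *. destruct Hex as (Hn1 & Hn2 & Hn3).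
  replace (2 * n - 1)%nat with (2 * (n - 1) + 1)%nat in Hn2 by lia.
  split; intros H.
  - apply (Hdown (i - 1)%nat (n - 1)%nat); [lia|trivial].
  - destruct (Nat.le_gt_cases i n) as [|Hgt]; trivial. exfalso.
    assert (s (2 * n + 1)%nat < lam) by (apply (Hdown n (i - 1)%nat); [lia|trivial]). lra.
Qed.

Lemma lambda_1_below : lambda_seq 1 < lam.
Proof. apply lambda_threshold; trivial. unfold lambda_poly. simpl. nra. Qed.

Lemma m1_spec i : (1 <= i)%nat -> ((i <= m1 lam)%nat <-> lambda_seq (2 * (i - 1) + 1) < lam).
Proof.
  apply (selected_index_spec lambda_seq).
  - apply lambda_admissible_down.
  - apply lambda_1_below.
  - apply lambda_admissible_bounded.
Qed.

Lemma m2_spec i : (1 <= i)%nat -> ((i <= m2 lam)%nat <-> gamma_seq (2 * (i - 1) + 1) < lam).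
Proof.
  intros Hi. unfold m2. destruct (Rlt_dec (gamma_seq 1) lam) as [H|H].
  - apply (selected_index_spec gamma_seq); trivial.
    + apply gamma_admissible_down.
    + apply gamma_admissible_bounded.
  - split; [lia|]. intros H'. exfalso. apply H.
    apply (gamma_admissible_down 0 (i - 1)); [lia|trivial].
Qed.

End Index.

(** * Periodic orbits and distances *)

Lemma pred_ext (P Q : C -> Prop) : (forall z, P z <-> Q z) -> P = Q.
Proof.
  intros H. apply functional_extensionality. intros z. apply propositional_extensionality, H.
Qed.

Lemma iterT_period lam p z m : iterT lam p z = z -> iterT lam (m * p) z = z.
Proof.
  intros E. induction m as [|m IH]; [reflexivity|].
  cbn [Nat.mul]. now rewrite iterT_add, IH.
Qed.

Lemma orbit_returns lam p z t : (0 < p)%nat -> iterT lam p z = z ->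
  exists s, iterT lam s (iterT lam t z) = z.
Proof.
  intros Hp E. exists (t * p - t)%nat. rewrite <- iterT_add.
  replace (t * p - t + t)%nat with (t * p)%nat by nia. now apply iterT_period.
Qed.

Lemma orbit_of_iterate lam p z t : (0 < p)%nat -> iterT lam p z = z ->
  orbit lam (iterT lam t z) = orbit lam z.
Proof.
  intros Hp E. apply pred_ext. intros y. split; intros [n ->].
  - exists (n + t)%nat. now rewrite iterT_add.
  - destruct (orbit_returns lam p z t Hp E) as [s Hs].
    exists (n + s)%nat. now rewrite iterT_add, Hs.
Qed.

Lemma orbit_period_le lam p q z y : minimal_period lam p z -> minimal_period lam q y ->
  orbit lam z = orbit lam y -> (q <= p)%nat.
Proof.
  intros (Hp & Ep & _) (Hq & _ & Hmin) E.
  assert (Hy : orbit lam z y) by (rewrite E; now exists 0%nat).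
  destruct Hy as [n ->]. destruct (Nat.le_gt_cases q p) as [|Hlt]; trivial. exfalso.
  apply (Hmin p); [lia|]. now rewrite <- iterT_add, Nat.add_comm, iterT_add, Ep.
Qed.

Lemma orbit_period_unique lam p q z y :
  minimal_period lam p z -> minimal_period lam q y -> orbit lam z = orbit lam y -> p = q.
Proof.
  intros Hp Hq E. apply Nat.le_antisymm.
  - now apply (orbit_period_le lam q p y z).
  - now apply (orbit_period_le lam p q z y).
Qed.

Lemma dist_set_bounds z (G : C -> Prop) y : G y -> 0 <= dist_set z G <= Cmod (z - y)%C.
Proof.
  intros Hy. unfold dist_set.
  set (E := fun r : R => exists y, G y /\ r = Cmod (z - y)%C).
  destruct (Glb_Rbar_correct E) as [Hlb Hgreat].
  assert (H1 : Rbar_le (Glb_Rbar E) (Cmod (z - y)%C)) by (apply Hlb; now exists y).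
  assert (H2 : Rbar_le 0 (Glb_Rbar E)).
  { apply Hgreat. intros r (x & _ & ->). apply Cmod_ge_0. }
  destruct (Glb_Rbar E); simpl in *; tauto || lra.
Qed.

(** * The attractor *)

Section Attraction.
Variable lam : R.
Hypothesis Hlam : 0 < lam < 1.

(** An exact form of attraction: it yields both convergence of distances and, for
    periodic z, equality of orbits. *)
Definition shadows (z g : C) : Prop :=
  exists t, forall q, Cmod (iterT lam (q + t) z - iterT lam q g)%C =
                      lam ^ q * Cmod (iterT lam t z - g)%C.

Lemma shadows_dist z g : shadows z g ->
  is_lim_seq (fun n => dist_set (iterT lam n z) (orbit lam g)) 0.
Proof.
  intros [t Ht]. apply (is_lim_seq_incr_n _ t).
  apply is_lim_seq_le_le with (u := fun _ => 0)
    (w := fun q => lam ^ q * Cmod (iterT lam t z - g)%C).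
  - intros q. rewrite <- Ht. apply dist_set_bounds. now exists q.
  - apply is_lim_seq_const.
  - replace (Finite 0) with (Rbar_mult 0 (Cmod (iterT lam t z - g)%C))
      by (simpl; f_equal; ring).
    apply is_lim_seq_scal_r, is_lim_seq_geom. rewrite Rabs_pos_eq; lra.
Qed.

(** At a common multiple of both periods the difference is reproduced, but also
    multiplied by a factor less than 1; so it vanishes. *)
Lemma shadows_periodic z g p r : shadows z g ->
  (0 < p)%nat -> iterT lam p z = z -> (0 < r)%nat -> iterT lam r g = g ->
  orbit lam z = orbit lam g.
Proof.
  intros [t Ht] Hp Ez Hr Eg. specialize (Ht (p * r)%nat).
  rewrite (iterT_period _ _ _ p Eg), Nat.add_comm, iterT_add, (Nat.mul_comm p r),
    (iterT_period _ _ _ r Ez) in Ht.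
  assert (Hpow : lam ^ (r * p) < 1) by (apply pow_lt_1_compat; lra || nia).
  assert (E : Cmod (iterT lam t z - g)%C = 0).
  { pose proof (Cmod_ge_0 (iterT lam t z - g)%C). nra. }
  apply Cmod_eq_0 in E.
  assert (E' : iterT lam t z = g).
  { replace (iterT lam t z) with (iterT lam t z - g + g)%C by ring. rewrite E. ring. }
  now rewrite <- E', (orbit_of_iterate lam p z t Hp Ez).
Qed.

Definition fixed_base (i : nat) : C :=
  let mu := lam ^ (2 * (i - 1) + 1) in
  cone_point lam 0 (/ (1 - mu + mu ^ 2)) (mu * / (1 - mu + mu ^ 2)).

Definition cycle_base (i : nat) : C :=
  cone_point lam 0 (cycle_V lam (i - 1) 0) (cycle_W lam (i - 1) 0).

Lemma fixed_base_periodic i : (1 <= i <= m1 lam)%nat ->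
  nonsingular lam (fixed_base i) /\ minimal_period lam (3 * (2 * i - 1)) (fixed_base i).
Proof.
  intros [Hi Hm]. apply (m1_spec lam Hlam i Hi), (lambda_admissible lam Hlam) in Hm.
  apply (coded_constant lam Hlam) in Hm. split.
  - exact (coded_nonsingular lam Hlam _ _ _ 0 Hm).
  - replace (3 * (2 * i - 1))%nat with (return_time (fun _ => (i - 1)%nat) 3)
      by (cbn [return_time]; lia).
    apply (coded_minimal_period lam Hlam _ _ _ 3 Hm); trivial; [lia|].
    intros [|[|[|n]]] Hn; simpl; lia.
Qed.

Lemma cycle_base_periodic i : (1 <= i <= m2 lam)%nat ->
  nonsingular lam (cycle_base i) /\ minimal_period lam (12 * i) (cycle_base i).
Proof.
  intros [Hi Hm]. apply (m2_spec lam Hlam i Hi), (gamma_admissible lam Hlam) in Hm.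
  apply (coded_alternating lam Hlam) in Hm. split.
  - exact (coded_nonsingular lam Hlam _ _ _ 0 Hm).
  - replace (12 * i)%nat with (return_time (alternating (i - 1)) 6)
      by (cbn [return_time alternating Nat.even]; lia).
    apply (coded_minimal_period lam Hlam _ _ _ 6 Hm); trivial; [lia|].
    (* The third return is in the right cone, but at the other point of the 2-cycle. *)
    assert (Hne : cycle_V lam (i - 1) 3 <> cycle_V lam (i - 1) 0).
    { unfold cycle_V. simpl Nat.even. cbv iota zeta.
      rewrite odd_pow.
      pose proof (pow_lam_bounds lam Hlam (2 * (i - 1))) as Hp.
      set (mu := lam * lam ^ (2 * (i - 1))).
      assert (Hmu : 0 < mu) by (unfold mu; nra).
      assert (Hd : 0 < 1 + (lam * mu) ^ 2 + (lam * mu) ^ 4)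
        by (assert (0 < lam * mu) by nra;
            assert (0 < (lam * mu) ^ 2) by (now apply pow_lt);
            assert (0 < (lam * mu) ^ 4) by (now apply pow_lt); lra).
      intros E. apply Rmult_eq_reg_r in E; [|apply Rinv_neq_0_compat; lra].
      assert (lam * (lam * mu) < mu) by (assert (lam * mu < mu) by nra; nra). lra. }
    intros [|[|[|[|[|[|n]]]]]] Hn; simpl; try lia. intros _. exact Hne.
Qed.

(** The orbit itself proves that its eventual pattern is admissible, and the
    admissible pattern has a periodic representative with the same symbols. *)
Lemma every_orbit_shadows z : nonsingular lam z ->
  (exists i, (1 <= i <= m1 lam)%nat /\ shadows z (fixed_base i)) \/
  (exists i, (1 <= i <= m2 lam)%nat /\ shadows z (cycle_base i)).
Proof.
  intros Hz.
  destruct (nonsingular_normal_form lam Hlam z Hz) as (t & K & V & W & E & [Hc|Hc]).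
  - left. exists (S K).
    pose proof (coded_constant_admissible lam Hlam K V W Hc) as Hadm.
    split.
    + split; [lia|]. apply (m1_spec lam Hlam (S K)); [lia|].
      apply (lambda_admissible lam Hlam). now replace (S K - 1)%nat with K by lia.
    + exists t. intros q. unfold fixed_base. replace (S K - 1)%nat with K by lia.
      rewrite iterT_add, E.
      apply (coded_contraction lam Hlam _ _ _ _ _ 0 q Hc (coded_constant lam Hlam K Hadm)).
  - right. exists (S K).
    pose proof (coded_alternating_admissible lam Hlam K V W Hc) as Hadm.
    split.
    + split; [lia|]. apply (m2_spec lam Hlam (S K)); [lia|].
      apply (gamma_admissible lam Hlam). now replace (S K - 1)%nat with K by lia.
    + exists t. intros q. unfold cycle_base. replace (S K - 1)%nat with K by lia.
      rewrite iterT_add, E.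
      apply (coded_contraction lam Hlam _ _ _ _ _ 0 q Hc (coded_alternating lam Hlam K Hadm)).
Qed.

End Attraction.

Theorem corollary4p13 (lam : R) (Hlam : 0 < lam < 1) :
  exists Gamma1 Gamma2 : nat -> C -> Prop,
    (forall i : nat, (1 <= i <= m1 lam)%nat ->
       periodic_orbit lam (3 * (2 * i - 1)) (Gamma1 i)) /\
    (forall i : nat, (1 <= i <= m2 lam)%nat ->
       periodic_orbit lam (12 * i) (Gamma2 i)) /\
    (forall i j : nat, (1 <= i <= m1 lam)%nat -> (1 <= j <= m1 lam)%nat ->
       Gamma1 i = Gamma1 j -> i = j) /\
    (forall i j : nat, (1 <= i <= m2 lam)%nat -> (1 <= j <= m2 lam)%nat ->
       Gamma2 i = Gamma2 j -> i = j) /\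
    (forall i j : nat, (1 <= i <= m1 lam)%nat -> (1 <= j <= m2 lam)%nat ->
       Gamma1 i <> Gamma2 j) /\
    (forall (p : nat) (G : C -> Prop), periodic_orbit lam p G ->
       (exists i : nat, (1 <= i <= m1 lam)%nat /\ G = Gamma1 i) \/
       (exists i : nat, (1 <= i <= m2 lam)%nat /\ G = Gamma2 i)) /\
    (forall z : C, nonsingular lam z ->
       (exists j : nat, (1 <= j <= m1 lam)%nat /\
          is_lim_seq (fun n => dist_set (iterT lam n z) (Gamma1 j)) 0) \/
       (exists j : nat, (1 <= j <= m2 lam)%nat /\
          is_lim_seq (fun n => dist_set (iterT lam n z) (Gamma2 j)) 0)).
Proof.
  exists (fun i => orbit lam (fixed_base lam i)), (fun i => orbit lam (cycle_base lam i)).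
  pose proof (fixed_base_periodic lam Hlam) as H1.
  pose proof (cycle_base_periodic lam Hlam) as H2.
  split; [|split; [|split; [|split; [|split; [|split]]]]].
  - intros i Hi. destruct (H1 i Hi). now exists (fixed_base lam i).
  - intros i Hi. destruct (H2 i Hi). now exists (cycle_base lam i).
  - intros i j Hi Hj E. destruct (H1 i Hi) as [_ Pi]. destruct (H1 j Hj) as [_ Pj].
    pose proof (orbit_period_unique _ _ _ _ _ Pi Pj E). lia.
  - intros i j Hi Hj E. destruct (H2 i Hi) as [_ Pi]. destruct (H2 j Hj) as [_ Pj].
    pose proof (orbit_period_unique _ _ _ _ _ Pi Pj E). lia.
  - intros i j Hi Hj E. destruct (H1 i Hi) as [_ Pi]. destruct (H2 j Hj) as [_ Pj].
    pose proof (orbit_period_unique _ _ _ _ _ Pi Pj E). lia.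
  - intros p G (z & Hz & (Hp & Ez & _) & ->).
    destruct (every_orbit_shadows lam Hlam z Hz) as [(i & Hi & Hs)|(i & Hi & Hs)];
      [left|right]; exists i; split; trivial.
    + destruct (H1 i Hi) as [_ (Hr & Eg & _)].
      exact (shadows_periodic lam Hlam _ _ _ _ Hs Hp Ez Hr Eg).
    + destruct (H2 i Hi) as [_ (Hr & Eg & _)].
      exact (shadows_periodic lam Hlam _ _ _ _ Hs Hp Ez Hr Eg).
  - intros z Hz.
    destruct (every_orbit_shadows lam Hlam z Hz) as [(i & Hi & Hs)|(i & Hi & Hs)];
      [left|right]; exists i; split; trivial; now apply shadows_dist.
Qed.
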